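(* Let $n\ge 3$ be even, let $0<c<d$ be real numbers, let $E=[0,c]\cup[d,\infty)$, and let $\widetilde\gamma=\{\widetilde\gamma_t\}_{0\le t\le 3n}$ be a real sequence. The following are equivalent: (1) $\widetilde\gamma$ admits an $E$-representing measure. (2) $\widetilde\gamma$ admits an $E$-representing finitely atomic measure. (3) The four matrices $$\underline{H}_{3n}(\widetilde\gamma),\quad \underline{H}_{3n-1}^{[0,\infty)}(\widetilde\gamma),\quad \underline{H}_{3n}^{(-\infty,c]\cup[d,\infty)}(\widetilde\gamma),\quad \underline{H}_{3n-1}^{[0,c]\cup[d,\infty)}(\widetilde\gamma)\qquad(\ast)$$ are positive semidefinite, and one of the following holds: (a) All matrices in $(\ast)$ are positive definite. (b) Let $H$ be the first matrix in the list $(\ast)$ that fails to be positive definite. Then $H\in\{\underline{H}_{3n}(\widetilde\gamma),\ \underline{H}_{3n}^{(-\infty,c]\cup[d,\infty)}(\widetilde\gamma)\}$, the sequence determined by $H$ is positively recursively generated, and, for the moments $\gamma_{3n+1}$ and $\gamma_{3n+2}$ uniquely determined by it (see context) and $\widehat\gamma=(\widetilde\gamma_0,\dots,\widetilde\gamma_{3n},\gamma_{3n+1},\gamma_{3n+2})$, the extended matrices $$\underline{H}_{3n+2}(\widehat\gamma),\quad \underline{H}_{3n+1}^{[0,\infty)}(\widehat\gamma),\quad \underline{H}_{3n+2}^{(-\infty,c]\cup[d,\infty)}(\widehat\gamma),\quad \underline{H}_{3n+1}^{[0,c]\cup[d,\infty)}(\widehat\gamma)$$ are positive semidefinite.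
   Context: An $E$-representing measure for $\widetilde\gamma$ is a positive Borel measure $\mu$ on $\mathbb{R}$ with $\operatorname{supp}\mu\subseteq E$ and $\widetilde\gamma_t=\int x^t\,d\mu$ for $0\le t\le 3n$. Hankel matrices: for a real sequence $\gamma=(\gamma_0,\gamma_1,\dots)$ (finite, long enough) put $H_m(\gamma)=(\gamma_{i+j})_{i,j=0}^m$. Define $\underline{H}_{2m}(\gamma)=H_m(\gamma)$; $\underline{H}_{2m+1}^{[0,\infty)}(\gamma)=(\gamma_{i+j+1})_{i,j=0}^{m}$; $\underline{H}_{2m}^{(-\infty,c]\cup[d,\infty)}(\gamma)=\bigl(cd\,\gamma_{i+j}-(c+d)\gamma_{i+j+1}+\gamma_{i+j+2}\bigr)_{i,j=0}^{m-1}$; $\underline{H}_{2m+1}^{[0,c]\cup[d,\infty)}(\gamma)=\bigl(cd\,\gamma_{i+j+1}-(c+d)\gamma_{i+j+2}+\gamma_{i+j+3}\bigr)_{i,j=0}^{m-1}$. (The lower index is the largest index of an entry of $\gamma$ occurring in the matrix.) Positively recursively generated: let $\delta=(\delta_0,\dots,\delta_{2k})$ be a real sequence with $H_k(\delta)\succeq0$. Its rank $r$ is $k+1$ if $H_k(\delta)$ is nonsingular and otherwise $r=\min\{i\ge0: H_i(\delta)\text{ is singular}\}$. $\delta$ is positively recursively generated if $H_{r-1}(\delta)\succ0$ and, with $(\varphi_0,\dots,\varphi_{r-1})^T:=H_{r-1}(\delta)^{-1}(\delta_r,\dots,\delta_{2r-1})^T$ (in the case $H_k(\delta)$ is singular),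 the recursion $\delta_j=\varphi_0\delta_{j-r}+\cdots+\varphi_{r-1}\delta_{j-1}$ holds for $j=r,\dots,2k$ (for $r=0$ this means $\delta=0$). Sequence determined by $H$ and the determined moments: the sequence $\delta=(\delta_0,\dots,\delta_{2k})$ determined by $H$ is the one with $H=H_k(\delta)$. If it is positively recursively generated (and $H$ singular), $\delta_{2k+1},\delta_{2k+2}$ are defined by the recursion $\delta_j=\varphi_0\delta_{j-r}+\cdots+\varphi_{r-1}\delta_{j-1}$ for $j=2k+1,2k+2$, where $r$ is the rank of $\delta$ and $(\varphi_0,\dots,\varphi_{r-1})^T=H_{r-1}(\delta)^{-1}(\delta_r,\dots,\delta_{2r-1})^T$ (for $r=0$ this means $\delta_{2k+1}=\delta_{2k+2}=0$). Concretely: if $H=\underline{H}_{3n}(\widetilde\gamma)$, then $\delta_t=\widetilde\gamma_t$ ($0\le t\le 3n$) and $\gamma_{3n+1}=\delta_{3n+1}$, $\gamma_{3n+2}=\delta_{3n+2}$; if $H=\underline{H}_{3n}^{(-\infty,c]\cup[d,\infty)}(\widetilde\gamma)$, then $\delta_t=cd\,\widetilde\gamma_t-(c+d)\widetilde\gamma_{t+1}+\widetilde\gamma_{t+2}$ ($0\le t\le 3n-2$) and $\gamma_{3n+1}=\delta_{3n-1}+(c+d)\widetilde\gamma_{3n}-cd\,\widetilde\gamma_{3n-1}$, $\gamma_{3n+2}=\delta_{3n}+(c+d)\gamma_{3n+1}-cd\,\widetilde\gamma_{3n}$. *)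

(* Defs.v *)
From HB Require Import structures.
From mathcomp Require Import all_boot all_order all_algebra.
From mathcomp Require Import all_classical all_reals all_analysis.

Set Implicit Arguments.
Unset Strict Implicit.
Unset Printing Implicit Defensive.

Import Order.TTheory GRing.Theory Num.Theory.
Import numFieldNormedType.Exports.

Local Open Scope classical_set_scope.
Local Open Scope ring_scope.

Section Measures.
Variable R : realType.
Implicit Type mu : {measure set (measurableTypeR R) -> \bar R}.

Definition support mu : set R :=
  [set x | forall U : set R, open U -> U x -> (0 < mu U)%E].

(* The integral alone takes the value -oo on a non-integrable power whose two
   parts are both infinite, so integrability is stated separately. *)
Definition representing (E : set R) (g : seq R) mu : Prop :=
  support mu `<=` E /\
  forall t, (t < size g)%N ->
    let p := fun x : measurableTypeR R => (((x : R) ^+ t)%:E) in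
    mu.-integrable setT p /\ (\int[mu]_x p x = (g`_t)%:E)%E.

(* The zero measure is finitely atomic, with m = 0. *)
Definition finitely_atomic mu : Prop :=
  exists (m : nat) (x w : 'I_m -> R),
    [/\ injective x, forall i, 0 < w i &
        forall A : set (measurableTypeR R), measurable A ->
          (mu A = \sum_(i < m) (w i)%:E * \d_(x i) A)%E].

End Measures.

Section Matrices.
Variable R : realFieldType.

Definition psdmx (m : nat) (A : 'M[R]_m) : Prop :=
  A^T = A /\ forall v : 'cV[R]_m, 0 <= (v^T *m A *m v) 0 0.

Definition pdmx (m : nat) (A : 'M[R]_m) : Prop :=
  A^T = A /\ forall v : 'cV[R]_m, v != 0 -> 0 < (v^T *m A *m v) 0 0.

(* [hankel m s] has size m, so H_m(s) is [hankel m.+1 s] and H_{-1}(s) is the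
   empty matrix. *)
Definition hankel (m : nat) (s : seq R) : 'M[R]_m :=
  \matrix_(i < m, j < m) s`_(i + j).

(* N is the largest index of s occurring in the matrix: N is even in [HR] and
   [Hgap], odd in [Hpos] and [Hposgap]. *)
Definition HR (N : nat) (s : seq R) : 'M[R]_(N./2.+1) :=
  hankel N./2.+1 s.

Definition Hpos (N : nat) (s : seq R) : 'M[R]_(N./2.+1) :=
  \matrix_(i, j) s`_(i + j + 1).

Definition Hgap (c d : R) (N : nat) (s : seq R) : 'M[R]_(N./2) :=
  \matrix_(i, j)
    (c * d * s`_(i + j) - (c + d) * s`_(i + j + 1) + s`_(i + j + 2)).

Definition Hposgap (c d : R) (N : nat) (s : seq R) : 'M[R]_(N./2) :=
  \matrix_(i, j)
    (c * d * s`_(i + j + 1) - (c + d) * s`_(i + j + 2) + s`_(i + j + 3)).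

Definition all_psd (c d : R) (N : nat) (s : seq R) : Prop :=
  [/\ psdmx (HR N s), psdmx (Hpos N.-1 s),
      psdmx (Hgap c d N s) & psdmx (Hposgap c d N.-1 s)].

Definition all_pd (c d : R) (N : nat) (s : seq R) : Prop :=
  [/\ pdmx (HR N s), pdmx (Hpos N.-1 s),
      pdmx (Hgap c d N s) & pdmx (Hposgap c d N.-1 s)].

(* Below, s = (s_0, ..., s_{2k}). *)

Definition hrank (k : nat) (s : seq R) : nat :=
  if hankel k.+1 s \in unitmx then k.+1
  else find (fun i => hankel i.+1 s \notin unitmx) (iota 0 k.+1).

Definition rg_coef (r : nat) (s : seq R) : 'cV[R]_r :=
  invmx (hankel r s) *m \col_(i < r) s`_(r + i).

Definition rg_step (r : nat) (phi : 'cV[R]_r) (s : seq R) (j : nat) : R :=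
  \sum_(i < r) phi i 0 * s`_(j - r + i).

Definition pos_rec_gen (k : nat) (s : seq R) : Prop :=
  let r := hrank k s in
  [/\ psdmx (hankel k.+1 s), pdmx (hankel r s) &
      hankel k.+1 s \notin unitmx ->
      forall j, (r <= j <= k.*2)%N -> s`_j = rg_step (rg_coef r s) s j].

(* (s_0, ..., s_{2k}, s_{2k+1}, s_{2k+2}), the last two by the recursion *)
Definition rg_extend (k : nat) (s : seq R) : seq R :=
  let phi := rg_coef (hrank k s) s in
  let s1 := rcons s (rg_step phi s k.*2.+1) in
  rcons s1 (rg_step phi s1 k.*2.+2).

(* The sequence with Hankel matrix [Hgap c d N s]: it has N - 1 terms. *)
Definition gap_seq (c d : R) (N : nat) (s : seq R) : seq R :=
  mkseq (fun t => c * d * s`_t - (c + d) * s`_t.+1 + s`_t.+2) N.-1.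

(* s extended by the two moments obtained from the extension of
   [gap_seq c d N s], for s = (s_0, ..., s_N) and N even *)
Definition gap_extend (c d : R) (N : nat) (s : seq R) : seq R :=
  let e := rg_extend N./2.-1 (gap_seq c d N s) in
  let g1 := e`_(N.-1) + (c + d) * s`_N - c * d * s`_(N.-1) in
  let g2 := e`_N + (c + d) * g1 - c * d * s`_N in
  rcons (rcons s g1) g2.

End Matrices.

(* Main.v *)
Require Import Defs.
From HB Require Import structures.
From mathcomp Require Import all_boot all_order all_algebra.
From mathcomp Require Import all_classical all_reals all_analysis.
From mathcomp Require Import measurable_realfun.
From mathcomp Require Import complex.
From mathcomp Require polyrcf.
From mathcomp Require Import ring lra zify.

Set Implicit Arguments.
Unset Strict Implicit.
Unset Printing Implicit Defensive.

Import Order.TTheory GRing.Theory Num.Theory.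
Import numFieldNormedType.Exports.

Local Open Scope classical_set_scope.
Local Open Scope ring_scope.

(* Write g = (X - c)(X - d).  Positivity of the four matrices says that the Riesz
   functional L is nonnegative on w f^2 for w in {1, X, g, X g}.

   Representation: if a monic q of degree s annihilates (L(q h) = 0) and L is
   definite below degree s, then q can have no double root and no quadratic factor,
   so it has s distinct real roots and Lagrange interpolation exhibits L as a sum of
   positive atoms at these roots.  If q generates the kernel of the first matrix, the
   atoms are placed in E by testing L on X l^2 and g l^2 with l a Lagrange polynomial.
   If p generates the kernel of the third matrix, take q = g p and test the roots of
   p with g l^2 and X g l^2.  When all four matrices are definite, add a large odd
   moment and then the least even moment keeping both even forms nonnegative: one of
   them becomes singular, and one of the two previous cases applies.

   Necessity: if L vanishes on a nonzero polynomial W that is nonnegative on E, the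
   measure is carried by the finitely many roots of W, and the moments of such an
   atomic measure obey the recursion given by the polynomial of its atoms. *)

(** * Gauss quadrature *)

Section RealFactorization.
Variable R : rcfType.
Implicit Types (p q u : {poly R}).

(** A complex root [a + bi] exists. If [b] is nonzero, the remainder of [u] modulo [(X - a)^2 + b^2]
    has the form [al + be X] and vanishes at this root; the imaginary part [be b] and then the real
    part [al + be a] force it to be zero. *)
Lemma real_root_or_quadratic_factor u : (1 < size u)%N ->
  (exists a, root u a) \/
  (exists a b, b != 0 /\ ('X - a%:P) ^+ 2 + (b ^+ 2)%:P %| u).
Proof.
move=> su.
pose j : {rmorphism R -> complex R} := real_complex R.
have /closed_rootP[[a b] ruz] : size (map_poly j u) != 1.
  by rewrite size_map_poly neq_ltn su orbT.
have zE : (a +i* b = j a + 'i%C * j b)%C by simpc.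
have ii : ('i%C : complex R) * 'i%C = -1 by rewrite -expr2 complex.sqr_i.
have iB (B : complex R) : ('i%C * B) ^+ 2 + B ^+ 2 = 0.
  by rewrite exprMn (expr2 'i%C) ii mulN1r addNr.
have jI x y : j x + 'i%C * j y = 0 -> x = 0 /\ y = 0.
  by move=> /eqP; rewrite /j /=; simpc; rewrite eq_complex /= => /andP[/eqP-> /eqP->].
have [b0|b0] := eqVneq b 0.
  left; exists a; move: ruz; rewrite zE b0 rmorph0 mulr0 addr0.
  by rewrite /root horner_map fmorph_eq0.
right; exists a, b; split => //.
pose v : {poly R} := ('X - a%:P) ^+ 2 + (b ^+ 2)%:P.
have sv : size v = 3.
  rewrite /v size_polyDl ?size_exp_XsubC // size_polyC.
  by case: (_ != 0).
have v0 : v != 0 by rewrite -size_poly_gt0 sv.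
have sr : (size (u %% v)%R <= 2)%N by have := ltn_modp u v; rewrite v0 sv.
have rE : u %% v = ((u %% v)`_0)%:P + (u %% v)`_1 *: 'X.
  apply/polyP=> i; rewrite coefD coefC coefZ coefX.
  case: i => [|[|i]] /=; rewrite ?(mulr1, mulr0, addr0, add0r) //.
  by rewrite nth_default // (leq_trans sr).
have vz : (map_poly j v).[(a +i* b)%C] = 0.
  rewrite /v rmorphD rmorphXn rmorphB /= map_polyX !map_polyC /= !hornerE zE /=.
  by rewrite addrAC subrr add0r rmorphXn iB.
have : (map_poly j (u %% v)).[(a +i* b)%C] = 0.
  move: ruz; rewrite {1}(divp_eq u v) rmorphD rmorphM /root !hornerE vz.
  by rewrite mulr0 add0r => /eqP.
rewrite rE rmorphD /= map_polyC map_polyZ map_polyX !hornerE zE /=.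
set al := _`_0; set be := _`_1 => h.
have [|h1 h2] := jI (al + be * a) (be * b).
  by rewrite -[RHS]h rmorphD !rmorphM /= mulrDr !addrA mulrCA.
have be0 : be = 0 by apply/eqP; move/eqP: h2; rewrite mulf_eq0 (negPf b0) orbF.
move: h1; rewrite be0 mul0r addr0 => al0.
by rewrite -/v /dvdp rE -/al -/be al0 be0 scale0r addr0.
Qed.

(** Induction on the degree: a real root is split off, and it cannot recur in the quotient because
    no square of a linear factor divides [q]. *)
Lemma real_rooted q : q \is monic ->
  (forall a, ~~ (('X - a%:P) ^+ 2 %| q)) ->
  (forall a b, b != 0 -> ~~ (('X - a%:P) ^+ 2 + (b ^+ 2)%:P %| q)) ->
  exists2 rs, uniq rs & q = \prod_(z <- rs) ('X - z%:P).
Proof.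
have [n] := ubnP (size q); elim: n q => // n IH q sq mq nsq nqu.
have q0 : q != 0 by exact: monic_neq0.
have [sq1|sq1] := leqP (size q) 1.
  exists [::] => //; rewrite big_nil.
  have sq1' : size q = 1 by apply/eqP; rewrite eqn_leq sq1 size_poly_gt0.
  by have := size1_polyC sq1 => ->; move: mq; rewrite qualifE/= lead_coefE sq1' => /eqP ->.
have [[a /factor_theorem[v qE]]|[a [b [b0 h]]]] := real_root_or_quadratic_factor sq1; last first.
  by have := nqu a b b0; rewrite h.
have mv : v \is monic by move: mq; rewrite qE monicMr // monicXsubC.
have dv : v %| q by rewrite qE dvdp_mulr.
have [||||rs urs vE] := IH v.
- rewrite (leq_trans _ (sq : (size q <= n)%N)) // qE size_Mmonic ?monicXsubC ?monic_neq0 //.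
  by rewrite size_XsubC addn2.
- by [].
- by move=> z; apply: contra (nsq z) => /dvdp_trans; exact.
- by move=> z b b0; apply: contra (nqu z b b0) => /dvdp_trans; exact.
exists (a :: rs); last by rewrite big_cons mulrC -vE.
rewrite /= urs andbT; apply: contra (nsq a) => ars.
by rewrite qE expr2 dvdp_mul // dvdp_XsubCl vE root_prod_XsubC.
Qed.

End RealFactorization.

Section Quadrature.
Variable R : rcfType.
Implicit Types (f g h p q : {poly R}) (zs : seq R).

(** Lagrange basis polynomial of the node [z]. *)
Definition node_poly zs z : {poly R} :=
  let p := \prod_(y <- rem z zs) ('X - y%:P) in p.[z]^-1 *: p.

Lemma size_node_poly zs z : z \in zs -> (size (node_poly zs z) <= size zs)%N.
Proof.
move=> zz; rewrite (leq_trans (size_scale_leq _ _)) // size_prod_XsubC size_rem //.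
by rewrite prednK //; case: (zs) zz.
Qed.

Lemma horner_node_poly zs z y : uniq zs -> z \in zs -> y \in zs ->
  (node_poly zs z).[y] = (y == z)%:R.
Proof.
move=> uzs zz yz; rewrite /node_poly hornerZ.
have [->|yNz] := eqVneq y z.
  rewrite mulVf // -rootE root_prod_XsubC mem_rem_uniq // inE /= eqxx //.
have -> : (\prod_(x <- rem z zs) ('X - x%:P)).[y] = 0.
  by apply/eqP; rewrite -rootE root_prod_XsubC mem_rem_uniq // !inE yNz.
by rewrite mulr0.
Qed.

Lemma node_poly_neq0 zs z : uniq zs -> z \in zs -> node_poly zs z != 0.
Proof.
move=> uzs zz; apply/eqP => h; have := horner_node_poly uzs zz zz.
by rewrite h horner0 eqxx => /eqP; rewrite eq_sym oner_eq0.
Qed.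

Variables (L : {scalar {poly R}}) (M s : nat) (q : {poly R}).
Hypotheses (q_monic : q \is monic) (sq : size q = s.+1) (sM : (s.*2 <= M.+2)%N).
Hypothesis Lq0 : forall h, (size (q * h)%R <= M.+1)%N -> L (q * h) = 0.
Hypothesis Lpos : forall f, f != 0 -> (size f <= s)%N -> 0 < L (f ^+ 2).

(* If the factor were square, or a sum of two squares, times [h], then [q * h]
   would be a sum of squares of polynomials of degree < s. *)
Lemma orthogonal_no_sum_squares g a (b : R) :
  g = 'X - a%:P -> ~~ (g ^+ 2 + (b ^+ 2)%:P %| q).
Proof.
move=> gE; apply/negP => /dvdpP[h qE].
have q0 : q != 0 by exact: monic_neq0.
have h0 : h != 0 by apply: contraNneq q0 => h0; rewrite qE h0 mul0r.
have g0 : g != 0 by rewrite gE polyXsubC_eq0.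
have sg : size (g ^+ 2 + (b ^+ 2)%:P) = 3.
  rewrite gE size_polyDl ?size_exp_XsubC // size_polyC.
  by case: (_ != 0).
have sh : (size h).+1 = s.
  have gg0 : g ^+ 2 + (b ^+ 2)%:P != 0 by rewrite -size_poly_gt0 sg.
  by move: sq; rewrite qE size_mul // sg addn3 /= => -[].
have sgh : (size (g * h)%R <= s)%N.
  by rewrite (leq_trans (size_polyMleq _ _)) // gE size_XsubC add2n /= sh.
have := Lq0 (h := h); rewrite size_mul // sq -sh => Lqh.
have : 0 < L ((g * h) ^+ 2) + b ^+ 2 * L (h ^+ 2).
  rewrite ltr_wpDr ?Lpos ?mulf_neq0 // mulr_ge0 ?sqr_ge0 // ltW // Lpos //.
  by rewrite -sh.
have -> : L ((g * h) ^+ 2) + b ^+ 2 * L (h ^+ 2) = L (q * h).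
  rewrite -linearZ -linearD; congr (L _); rewrite qE -mul_polyC; ring.
rewrite Lqh ?ltxx //; move: sM; rewrite -sh -addnn; move: (size h); lia.
Qed.

(** The nodes are the roots of [q]; the weight of [z] is the value of [L] at the square of the
    Lagrange polynomial of [z], which makes its positivity immediate. *)
Lemma gauss_quadrature : exists zs (w : R -> R),
  [/\ uniq zs, q = \prod_(z <- zs) ('X - z%:P),
      forall z, z \in zs -> 0 < w z,
      forall a, ~~ (('X - a%:P) ^+ 2 %| q) &
      forall f, (size f <= M.+1)%N -> L f = \sum_(z <- zs) w z * f.[z]].
Proof.
(* A double root is the case [b = 0] of the excluded factor. *)
have nsq a : ~~ (('X - a%:P) ^+ 2 %| q).
  by have := @orthogonal_no_sum_squares _ a 0 erefl; rewrite expr0n addr0.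
have [|zs uzs qE] := real_rooted q_monic nsq.
  by move=> a b _; exact: (@orthogonal_no_sum_squares _ a b erefl).
have szs : size zs = s by move: sq; rewrite qE size_prod_XsubC => -[].
exists zs, (fun z => L (node_poly zs z ^+ 2)); split => //.
  move=> z zz; rewrite Lpos ?node_poly_neq0 //.
  by rewrite (leq_trans (size_node_poly zz)) // szs.
(* Squared Lagrange polynomials still interpolate and stay within degree [M]. The difference [D]
   vanishes at all nodes, so it is a multiple of [q] and [L] kills it. *)
move=> f sf; pose D := f - \sum_(z <- zs) f.[z] *: node_poly zs z ^+ 2.
have size_term z : z \in zs -> (size (f.[z] *: node_poly zs z ^+ 2) <= M.+1)%N.
  move=> zz; rewrite (leq_trans (size_scale_leq _ _)) // expr2.
  rewrite (leq_trans (size_polyMleq _ _)) //.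
  by move: (size_node_poly zz) sM; rewrite szs; lia.
have sD : (size D <= M.+1)%N.
  rewrite (leq_trans (size_polyD _ _)) // geq_max sf size_polyN /=.
  rewrite big_seq; elim/big_ind: _ => //; first by rewrite size_poly0.
  by move=> x y sx sy; rewrite (leq_trans (size_polyD _ _)) // geq_max sx.
have rD : all (root D) zs.
  apply/allP => y yz; rewrite /root /D hornerD hornerN horner_sum.
  rewrite (bigD1_seq y) //= hornerZ horner_exp horner_node_poly // eqxx expr1n mulr1.
  rewrite big_seq_cond big1 ?addr0 ?subrr // => z /andP[zz zy].
  by rewrite hornerZ horner_exp horner_node_poly // eq_sym (negPf zy) expr0n mulr0.
have /dvdpP[h DE] : q %| D.
  by rewrite qE uniq_roots_dvdp // uniq_rootsE.
have LD0 : L D = 0 by rewrite DE mulrC Lq0 // mulrC -DE.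
have -> : f = D + \sum_(z <- zs) f.[z] *: node_poly zs z ^+ 2 by rewrite /D subrK.
rewrite linearD LD0 add0r linear_sum /=; apply: eq_big_seq => z zz.
by rewrite linearZ /= mulrC /D subrK.
Qed.

End Quadrature.

(** A nonzero row of the left kernel would be a nonzero vector at which the form vanishes. *)
Lemma definite_unitmx (F : fieldType) m (A : 'M[F]_m) :
  (forall v : 'cV_m, v != 0 -> (v^T *m A *m v) 0 0 != 0) -> A \in unitmx.
Proof.
move=> H; rewrite -row_free_unit -kermx_eq0; apply/eqP/row_matrixP => i.
rewrite row0; set v := row i _; apply/eqP/negPn/negP => v0.
have vA : v *m A = 0 by apply/sub_kermxP; rewrite row_sub.
have vT0 : v^T != 0 by rewrite trmx_eq0.
by have := H _ vT0; rewrite trmxK vA mul0mx mxE eqxx.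
Qed.

(** * The Riesz functional of a moment sequence *)

Section RieszFunctional.
Variable R : rcfType.
Implicit Types (s : nat -> R) (f g h p q w : {poly R}) (zs : seq R).

(** The sequence is a total function, which makes the functional linear on all polynomials. A finite
    list enters as [nth 0 l], and statements then bound the degrees by its length. *)
Definition riesz s p : R := \sum_(i < size p) p`_i * s i.

Lemma riesz_widen s n p : (size p <= n)%N -> riesz s p = \sum_(i < n) p`_i * s i.
Proof.
move=> sp; rewrite /riesz (big_ord_widen _ (fun i => p`_i * s i) sp).
rewrite [RHS](bigID (fun i : 'I_n => (i < size p)%N)) /= [X in _ = _ + X]big1 ?addr0 //.
by move=> i; rewrite -leqNgt => le; rewrite nth_default // mul0r.
Qed.

Fact riesz_is_scalar s : scalar (riesz s).
Proof.
move=> a p q; pose n := maxn (size (a *: p + q)) (maxn (size p) (size q)).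
rewrite !(@riesz_widen s n) ?leq_max ?leqnn ?orbT //.
rewrite mulr_sumr -big_split /=; apply: eq_bigr => i _.
by rewrite coefD coefZ mulrDl mulrA.
Qed.

HB.instance Definition _ s :=
  GRing.isLinear.Build R {poly R} R *%R (riesz s) (riesz_is_scalar s).

Lemma rieszZ s a p : riesz s (a *: p) = a * riesz s p.
Proof. exact: linearZ. Qed.

Lemma riesz_Xn s n : riesz s 'X^n = s n.
Proof.
rewrite /riesz size_polyXn big_ord_recr /= coefXn eqxx mul1r.
rewrite big1 ?add0r // => i _; rewrite coefXn.
by rewrite ltn_eqF ?ltn_ord // mul0r.
Qed.

Definition add_moment s k a : nat -> R := fun i => s i + (i == k)%:R * a.

Lemma riesz_add_moment s k a p : riesz (add_moment s k a) p = riesz s p + a * p`_k.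
Proof.
pose n := maxn k.+1 (size p).
rewrite !(@riesz_widen _ n) ?leq_max ?leqnn ?orbT //.
have kn : (k < n)%N by rewrite leq_max leqnn.
under eq_bigr do rewrite mulrDr.
rewrite big_split /=; congr (_ + _).
rewrite (bigD1 (Ordinal kn)) //= eqxx mul1r mulrC big1 ?addr0 // => i.
by rewrite -val_eqE /= => /negPf ->; rewrite mul0r mulr0.
Qed.

(** Positivity of the localizing matrix of weight [w] and size [m], vectors being read as
    polynomials of degree less than [m]. *)
Definition sos_nonneg s w m := forall f, (size f <= m)%N -> 0 <= riesz s (w * f ^+ 2).
Definition sos_pos s w m :=
  forall f, f != 0 -> (size f <= m)%N -> 0 < riesz s (w * f ^+ 2).

Lemma sos_pos_nonneg s w m : sos_pos s w m -> sos_nonneg s w m.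
Proof.
move=> H f sf; have [->|f0] := eqVneq f 0; first by rewrite expr0n mulr0 linear0.
exact/ltW/H.
Qed.

Lemma riesz_orthogonal_split s w g f a : riesz s (w * g * f) = 0 ->
  riesz s (w * (f + a *: g) ^+ 2) = riesz s (w * f ^+ 2) + a ^+ 2 * riesz s (w * g ^+ 2).
Proof.
move=> h0.
have -> : w * (f + a *: g) ^+ 2
    = w * f ^+ 2 + a ^+ 2 *: (w * g ^+ 2) + (2 * a) *: (w * g * f).
  by rewrite -!mul_polyC !rmorphM /= polyC_natr; ring.
by rewrite !linearD !linearZ /= h0 mulr0 addr0.
Qed.

Section MonicOrthogonal.
Variables (s : nat -> R) (w g : {poly R}) (m : nat).
Hypotheses (g_monic : g \is monic) (sg : size g = m.+1).
Hypothesis g_orth : forall f, (size f <= m)%N -> riesz s (w * g * f) = 0.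

Lemma monic_reduce f : (size f <= m.+1)%N ->
  exists2 f0 : {poly R}, (size f0 <= m)%N & f = f0 + f`_m *: g.
Proof.
move=> sf; exists (f - f`_m *: g); last by rewrite subrK.
have sle : (size (f - f`_m *: g)%R <= m.+1)%N.
  by rewrite (leq_trans (size_polyD _ _)) // geq_max sf size_polyN
     (leq_trans (size_scale_leq _ _)) // sg.
apply/leq_sizeP => j; rewrite leq_eqVlt => /predU1P[<-|mj].
  rewrite coefB coefZ; move/monicP: g_monic; rewrite lead_coefE sg /= => ->.
  by rewrite mulr1 subrr.
by rewrite nth_default // (leq_trans sle).
Qed.

(** As [g] is orthogonal to lower degrees, the bordered form is the form below degree [m] plus the
    squared top coefficient times [riesz s (w * g ^+ 2)]. This last number is the Schur
    complement. *)
Lemma sos_nonneg_extend :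
  sos_nonneg s w m -> 0 <= riesz s (w * g ^+ 2) -> sos_nonneg s w m.+1.
Proof.
move=> H g0 f /monic_reduce[f0 sf0 ->].
by rewrite riesz_orthogonal_split ?g_orth // addr_ge0 ?H // mulr_ge0 ?sqr_ge0.
Qed.

Lemma sos_pos_extend :
  sos_pos s w m -> 0 < riesz s (w * g ^+ 2) -> sos_pos s w m.+1.
Proof.
move=> H g0 f fn0 /monic_reduce[f0 sf0 fE].
rewrite fE riesz_orthogonal_split ?g_orth //.
have [fm0|fm0] := eqVneq f`_m 0.
  rewrite fm0 expr0n mul0r addr0 H //.
  by apply: contraNneq fn0 => f00; rewrite fE f00 fm0 scale0r addr0.
have a0 : 0 < f`_m ^+ 2 by rewrite exprn_even_gt0.
by rewrite ltr_wpDl ?(sos_pos_nonneg H) // mulr_gt0.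
Qed.

(** With zero Schur complement, [g] is orthogonal to itself too, hence to everything of degree at
    most [m]. *)
Lemma orthogonal_kernel : riesz s (w * g ^+ 2) = 0 ->
  forall f, (size f <= m.+1)%N -> riesz s (w * g * f) = 0.
Proof.
move=> g0 f /monic_reduce[f0 sf0 ->].
by rewrite mulrDr linearD /= g_orth // add0r -scalerAr linearZ /= -mulrA -expr2 g0 mulr0.
Qed.

End MonicOrthogonal.

Lemma quadratic_form_riesz s w m (A : 'M[R]_m) (v : 'cV[R]_m) :
  (forall i j, A i j = riesz s (w * 'X^(i + j))) ->
  (v^T *m A *m v) 0 0 = riesz s (w * rVpoly v^T ^+ 2).
Proof.
move=> AE; rewrite !mxE.
have -> : rVpoly v^T = \sum_(i < m) v i 0 *: 'X^i.
  rewrite [v^T in LHS]row_sum_delta linear_sum /=; apply: eq_bigr => i _.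
  by rewrite linearZ /= rVpoly_delta mxE.
rewrite expr2 mulr_suml mulr_sumr linear_sum /=.
under eq_bigr do rewrite !mxE mulr_suml.
rewrite exchange_big /=; apply: eq_bigr => i _.
rewrite mulr_sumr mulr_sumr linear_sum /=; apply: eq_bigr => j _.
have -> : w * (v i 0 *: 'X^i * (v j 0 *: 'X^j)) = (v i 0 * v j 0) *: (w * 'X^(i + j)).
  by rewrite exprD -!mul_polyC rmorphM /=; ring.
by rewrite rieszZ !mxE AE; ring.
Qed.

(** Definiteness makes the matrix of the form invertible, so the normal equations for projecting
    ['X^m] onto lower degrees are solvable. *)
Lemma exists_monic_orthogonal s w m : sos_pos s w m ->
  exists2 g : {poly R}, g \is monic /\ size g = m.+1 &
    forall f, (size f <= m)%N -> riesz s (w * g * f) = 0.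
Proof.
move=> H; pose A := \matrix_(i < m, j < m) riesz s (w * 'X^(i + j)).
have uA : A \in unitmx.
  apply: definite_unitmx => v v0; have rv0 : rVpoly v^T != 0.
    apply: contraNneq v0 => rv.
    by rewrite -[v]trmxK -[v^T]rVpolyK rv linear0 trmx0.
  rewrite (@quadratic_form_riesz s w); last by move=> i j; rewrite mxE.
  by rewrite gt_eqF // H // size_poly.
pose b := \col_(i < m) riesz s (w * 'X^(m + i)).
pose phi := invmx A *m b.
have Aphi : A *m phi = b by rewrite mulKVmx.
pose g0 := \sum_(i < m) phi i 0 *: 'X^i : {poly R}.
have sg0 : (size g0 <= m)%N.
  rewrite /g0; elim/big_ind: _ => [|x y sx sy|i _]; first by rewrite size_poly0.
    by rewrite (leq_trans (size_polyD _ _)) // geq_max sx.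
  by rewrite (leq_trans (size_scale_leq _ _)) // size_polyXn.
have sg : size ('X^m - g0) = m.+1.
  by rewrite size_polyDl size_polyXn // size_polyN ltnS.
exists ('X^m - g0).
  split => //; apply/monicP; rewrite lead_coefE sg /= coefB coefXn eqxx.
  by rewrite nth_default // subr0.
move=> f sf.
have -> : f = \sum_(i < m) f`_i *: 'X^i.
  by rewrite -poly_def; apply/polyP => i; rewrite coef_poly; case: ltnP => // /(leq_trans sf) ?; rewrite nth_default.
rewrite mulr_sumr linear_sum big1 //= => i _.
rewrite -scalerAr rieszZ mulrBr mulrBl linearB /= -mulrA -exprD.
(* Row [i] of the normal equations is orthogonality to ['X^i]. *)
have := congr1 (fun B : 'cV_m => B i 0) Aphi; rewrite !mxE => <-.
rewrite /g0 mulr_sumr mulr_suml (linear_sum (riesz s)) /= -sumrB big1 ?mulr0 // => j _.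
by rewrite !mxE -scalerAr -scalerAl rieszZ -mulrA -exprD mulrC addnC subrr.
Qed.

Lemma riesz_top_moment s k a p : p \is monic -> size p = k.+1 ->
  riesz (add_moment s k a) p = riesz s p + a.
Proof.
move=> /monicP pm sp; move: pm; rewrite lead_coefE sp riesz_add_moment /= => ->.
by rewrite mulr1.
Qed.

Lemma riesz_low_moment s k a p : (size p <= k)%N ->
  riesz (add_moment s k a) p = riesz s p.
Proof. by move=> sp; rewrite riesz_add_moment nth_default // mulr0 addr0. Qed.

End RieszFunctional.

(** * Atomic solutions *)

Section AtomicSolutions.
Variable R : rcfType.
Implicit Types (s : nat -> R) (f g h p q w : {poly R}) (zs : seq R) (u : R -> R).

(** Nothing is asked beyond index [M], so atoms found for an extended sequence also serve for its
    truncation. *)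
Definition atomic s M zs u : Prop :=
  [/\ uniq zs, forall z, z \in zs -> 0 < u z &
      forall t, (t <= M)%N -> s t = \sum_(z <- zs) u z * z ^+ t].

Lemma atomic_riesz s M zs u p : atomic s M zs u -> (size p <= M.+1)%N ->
  riesz s p = \sum_(z <- zs) u z * p.[z].
Proof.
move=> [_ _ sE] sp; rewrite (riesz_widen _ sp).
under eq_bigr => i _ do rewrite (sE _ (ltn_ord i)) mulr_sumr.
rewrite exchange_big /=; apply: eq_bigr => z _.
by rewrite (horner_coef_wide _ sp) mulr_sumr; apply: eq_bigr => i _; rewrite mulrCA.
Qed.

Lemma atomic_of_riesz s M zs u : uniq zs -> (forall z, z \in zs -> 0 < u z) ->
  (forall f, (size f <= M.+1)%N -> riesz s f = \sum_(z <- zs) u z * f.[z]) ->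
  atomic s M zs u.
Proof.
move=> uzs u0 H; split=> // t tM; rewrite -riesz_Xn H ?size_polyXn //.
by apply: eq_bigr => z _; rewrite hornerXn.
Qed.

Variables c d : R.

Definition gap : {poly R} := ('X - c%:P) * ('X - d%:P).

Lemma gap_monic : gap \is monic.
Proof. by rewrite monicMl monicXsubC. Qed.

Lemma size_gap : size gap = 3.
Proof. by rewrite size_Mmonic ?monicXsubC ?polyXsubC_eq0 // !size_XsubC. Qed.

Lemma horner_gap x : gap.[x] = (x - c) * (x - d).
Proof. by rewrite !hornerE. Qed.

Lemma riesz_gap s i :
  riesz s (gap * 'X^i) = c * d * s i - (c + d) * s i.+1 + s i.+2.
Proof.
have -> : gap * 'X^i = (c * d) *: 'X^i - (c + d) *: 'X^(i.+1) + 'X^(i.+2) :> {poly R}.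
  by rewrite /gap -!mul_polyC rmorphM rmorphD /= !exprS; ring.
by rewrite linearD linearB /= !linearZ /= !riesz_Xn.
Qed.

Lemma riesz_Xgap s i :
  riesz s ('X * gap * 'X^i) = c * d * s i.+1 - (c + d) * s i.+2 + s i.+3.
Proof. by rewrite -riesz_gap exprS mulrA (mulrC gap). Qed.

(** The first [n] terms of [s'] are the moments of the functional weighted by [w]; linearity carries
    the identity from monomials to polynomials. *)
Lemma riesz_twist s s' n w p : (forall i, (i < n)%N -> s' i = riesz s (w * 'X^i)) ->
  (size p <= n)%N -> riesz s' p = riesz s (w * p).
Proof.
move=> e sp; rewrite (riesz_widen _ sp) -[p in RHS]coefK poly_def.
rewrite mulr_sumr linear_sum /= (big_ord_widen _ (fun i => riesz s (w * (p`_i *: 'X^i))) sp).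
rewrite [LHS](bigID (fun i : 'I_n => (i < size p)%N)) /= [X in _ + X = _]big1 ?addr0.
  by apply: eq_bigr => i _; rewrite e // -scalerAr linearZ.
by move=> i; rewrite -leqNgt => le; rewrite nth_default // mul0r.
Qed.

(** The set E given by polynomial inequalities, the form in which the functional can test an
    atom. *)
Definition in_gap_set (x : R) : bool := (0 <= x) && (0 <= gap.[x]).

Lemma size_sandwich w f : f != 0 -> (size (w * f ^+ 2)%R <= size w + (size f).*2 - 2)%N.
Proof.
rewrite -size_poly_gt0 => f0.
rewrite (leq_trans (size_polyMleq _ _)) // expr2.
by have := size_polyMleq f f; rewrite -addnn; lia.
Qed.

Lemma size_sandwich_le w f m n : (size f <= m)%N -> (size w + m.*2 <= n.+2)%N ->
  (size (w * f ^+ 2)%R <= n)%N.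
Proof.
move=> sf swm; have [->|f0] := eqVneq f 0; first by rewrite expr0n mulr0 size_poly0.
by rewrite (leq_trans (size_sandwich _ f0)) //; lia.
Qed.

(** The atoms come from Gauss quadrature at the roots of [q]. At [w l^2], with [l] the Lagrange
    polynomial of an atom [z], the quadrature sum reduces to [u z * w.[z]]; the weights ['X] and
    [gap] then locate [z]. *)
Lemma atomic_of_orthogonal s M r q : q \is monic -> size q = r.+1 -> (r.*2 <= M)%N ->
  (forall h, (size (q * h)%R <= M.+1)%N -> riesz s (q * h) = 0) ->
  sos_pos s 1 r -> sos_nonneg s 'X r -> sos_nonneg s gap r ->
  exists zs u, atomic s M zs u /\ {in zs, forall z, in_gap_set z}.
Proof.
move=> mq sq rM q0 s1 sX sg.
have s1' f : f != 0 -> (size f <= r)%N -> 0 < riesz s (f ^+ 2).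
  by move=> f0 sf; have := s1 f f0 sf; rewrite mul1r.
have rM' : (r.*2 <= M.+2)%N by lia.
have [zs [u [uzs qE u0 _ sE]]] := gauss_quadrature mq sq rM' q0 s1'.
have {}sE f : (size f <= M.+1)%N -> riesz s f = \sum_(z <- zs) u z * f.[z] := sE f.
exists zs, u; split; first exact: atomic_of_riesz.
have szs : size zs = r by move: sq; rewrite qE size_prod_XsubC => -[].
move=> z zz; have test w : (size w <= 3)%N -> sos_nonneg s w r -> 0 <= w.[z].
  move=> sw Hw; have sl := size_node_poly zz; rewrite szs in sl.
  have := Hw _ sl.
  have lz0 := node_poly_neq0 uzs zz.
  rewrite sE; last first.
    rewrite (leq_trans (size_sandwich _ _)) //.
    by move: sl sw; lia.
  rewrite (bigD1_seq z) //= big_seq_cond big1 ?addr0; last first.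
    move=> y /andP[yz yNz]; rewrite hornerM horner_exp horner_node_poly //.
    by rewrite (negPf yNz) expr0n !mulr0.
  by rewrite hornerM horner_exp horner_node_poly // eqxx expr1n mulr1 pmulr_rge0 ?u0.
rewrite /in_gap_set test ?size_gap // andbT.
by have := test 'X; rewrite hornerX size_polyX => ->.
Qed.

(** Here [w * f ^+ 2] has degree less than [n] and does not see the altered moment. *)
Lemma sos_nonneg_low s w m n a : (size w + m.*2 <= n.+2)%N ->
  sos_nonneg s w m -> sos_nonneg (add_moment s n a) w m.
Proof.
move=> swm H f sf; have [->|f0] := eqVneq f 0; first by rewrite expr0n mulr0 linear0.
rewrite riesz_low_moment ?H // (leq_trans (size_sandwich _ f0)) //; lia.
Qed.

Lemma sos_pos_low s w m n a : (size w + m.*2 <= n.+2)%N ->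
  sos_pos s w m -> sos_pos (add_moment s n a) w m.
Proof.
move=> swm H f f0 sf.
rewrite riesz_low_moment ?H // (leq_trans (size_sandwich _ f0)) //; lia.
Qed.

Lemma sos_nonneg_le s w m n : (m <= n)%N -> sos_nonneg s w n -> sos_nonneg s w m.
Proof. by move=> mn H f sf; rewrite H // (leq_trans sf). Qed.

(* [C] is the value of the top moment at which the Schur complement of the
   bordered form vanishes. *)
Lemma extend_moment s w m n : w \is monic -> (size w + m.*2 = n.+1)%N -> sos_pos s w m ->
  exists g C, [/\ g \is monic /\ size g = m.+1,
    forall a, C <= a -> sos_nonneg (add_moment s n a) w m.+1,
    forall a, C < a -> sos_pos (add_moment s n a) w m.+1 &
    forall f, (size f <= m.+1)%N -> riesz (add_moment s n C) (w * g * f) = 0].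
Proof.
move=> mw sw H; have [g [mg sg] og] := exists_monic_orthogonal H.
(* The polynomial [w * g ^+ 2] is monic of degree exactly [n], so the Schur complement moves by
   [a]. *)
have top a : riesz (add_moment s n a) (w * g ^+ 2) = riesz s (w * g ^+ 2) + a.
  apply: riesz_top_moment; first by rewrite monicMr // monic_exp.
  rewrite size_Mmonic ?monic_neq0 ?monic_exp // expr2 size_Mmonic ?monic_neq0 //.
  by move: sw; rewrite sg; lia.
have og' a f : (size f <= m)%N -> riesz (add_moment s n a) (w * g * f) = 0.
  move=> sf; rewrite riesz_low_moment ?og //.
  have := size_polyMleq (w * g) f; have := size_polyMleq w g.
  by move: sw; rewrite sg; lia.
have Hlow a : sos_pos (add_moment s n a) w m.
  by apply: sos_pos_low => //; rewrite sw.
exists g, (- riesz s (w * g ^+ 2)); split=> // [a Ca|a Ca|].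
- apply: (sos_nonneg_extend mg sg (og' a)); first exact: sos_pos_nonneg.
  by rewrite top; lra.
- by apply: (sos_pos_extend mg sg (og' a)) => //; rewrite top; lra.
- by apply: (orthogonal_kernel mg sg (og' _)); rewrite top subrr.
Qed.

Hypotheses (c_ge0 : 0 <= c) (d_ge0 : 0 <= d).

(** Quadrature is applied to [gap * p], of degree [r + 2], which is why definiteness is required
    below that degree. The roots [c] and [d] of [gap] lie in E; a root of [p] alone is tested with
    the cofactor of its linear factor. *)
Lemma atomic_of_gap_orthogonal s M r p : p \is monic -> size p = r.+1 -> (r.*2.+2 <= M)%N ->
  (forall h, (size (gap * p * h)%R <= M.+1)%N -> riesz s (gap * p * h) = 0) ->
  sos_pos s 1 r.+2 -> sos_nonneg s gap r -> sos_nonneg s ('X * gap) r ->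
  exists zs u, atomic s M zs u /\ {in zs, forall z, in_gap_set z}.
Proof.
move=> mp sp rM q0 s1 sg sXg.
have mq : gap * p \is monic by rewrite monicMr // gap_monic.
have sq : size (gap * p) = r.+3.
  by rewrite size_Mmonic ?monic_neq0 ?gap_monic // size_gap sp.
have s1' f : f != 0 -> (size f <= r.+2)%N -> 0 < riesz s (f ^+ 2).
  by move=> f0 sf; have := s1 f f0 sf; rewrite mul1r.
have rM' : (r.+2.*2 <= M.+2)%N by lia.
have [zs [u [uzs qE u0 nsq sE]]] := gauss_quadrature mq sq rM' q0 s1'.
have {}sE f : (size f <= M.+1)%N -> riesz s f = \sum_(z <- zs) u z * f.[z] := sE f.
exists zs, u; split; first exact: atomic_of_riesz.
move=> z zz; rewrite /in_gap_set.
have : root (gap * p) z by rewrite qE root_prod_XsubC.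
rewrite rootM => /orP[|/factor_theorem[p' pE]].
  move=> gz; move: (gz); rewrite /root => /eqP ->; rewrite lexx andbT.
  by move: gz; rewrite rootM !root_XsubC => /orP[] /eqP ->.
have [gz0|gz0] := eqVneq gap.[z] 0.
  move/eqP: gz0; rewrite -rootE rootM !root_XsubC => /orP[] /eqP ->;
  by rewrite ?c_ge0 ?d_ge0 horner_gap subrr ?mul0r ?mulr0 lexx.
(* Otherwise [z] would be a double root of [gap * p], which quadrature excludes. *)
have p'z : p'.[z] != 0.
  apply: contraNneq (nsq z) => /eqP; rewrite -rootE => /factor_theorem[p2 p'E].
  by rewrite pE p'E -mulrA -expr2 mulrA dvdp_mulIr.
have sp' : size p' = r.
  have p'0 : p' != 0 by apply: contraNneq p'z => ->; rewrite horner0.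
  by move: sp; rewrite pE size_Mmonic ?monicXsubC // size_XsubC addn2 => -[].
(* [gap * p'] vanishes at every atom other than [z]. *)
have test w : (size w <= 2)%N -> riesz s (w * gap * p' ^+ 2) = u z * (w.[z] * gap.[z] * p'.[z] ^+ 2).
  move=> sw; have p'0 : p' != 0 by apply: contraNneq p'z => ->; rewrite horner0.
  rewrite sE; last first.
    rewrite (leq_trans (size_sandwich _ _)) //.
    by have := size_polyMleq w gap; rewrite size_gap sp'; lia.
  rewrite (bigD1_seq z) //= big_seq_cond big1 ?addr0 ?hornerM ?horner_exp //.
  move=> y /andP[yz yNz]; have : root (gap * p) y by rewrite qE root_prod_XsubC.
  rewrite pE mulrA rootM root_XsubC (negPf yNz) orbF rootE => /eqP h.
  have -> : w * gap * p' ^+ 2 = gap * p' * (w * p') by ring.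
  by rewrite hornerM h mul0r mulr0.
have p2 : 0 < p'.[z] ^+ 2 by rewrite exprn_even_gt0.
have g0 : 0 < gap.[z].
  rewrite lt_def gz0 /=; have := sg p'; rewrite sp' leqnn => /(_ isT).
  have := test 1; rewrite size_poly1 mul1r hornerC mul1r => -> //.
  by rewrite pmulr_rge0 ?u0 // pmulr_lge0.
rewrite (ltW g0) andbT; have := sXg p'; rewrite sp' leqnn => /(_ isT).
rewrite test ?size_polyX // pmulr_rge0 ?u0 // pmulr_lge0 // pmulr_lge0 // hornerX //.
Qed.

(* The moment of degree [2k+3] is taken large, and that of degree [2k+4] as small
   as positivity allows, so that one of two extended forms becomes singular. *)
Lemma atomic_of_positive_definite s k :
  sos_pos s 1 k.+2 -> sos_pos s 'X k.+1 -> sos_pos s gap k.+1 -> sos_pos s ('X * gap) k ->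
  exists zs u, atomic s k.+1.*2 zs u /\ {in zs, forall z, in_gap_set z}.
Proof.
move=> H1 HX Hg HXg.
have mXg : 'X * gap \is monic by rewrite monicMr ?monicX // gap_monic.
have sXg : size ('X * gap)%R = 4.
  by rewrite size_Mmonic ?polyX_eq0 ?gap_monic // size_polyX size_gap.
have [|_ [C1 [_ HX1 _ _]]] := @extend_moment s 'X k.+1 k.*2.+3 (monicX _) _ HX.
  by rewrite size_polyX; lia.
have [|_ [C2 [_ HXg1 _ _]]] := @extend_moment s ('X * gap) k k.*2.+3 mXg _ HXg.
  by rewrite sXg; lia.
(* Reaching both thresholds makes both odd forms nonnegative at the enlarged size; the two even
   forms, at their present sizes, do not involve this moment. *)
pose s1 := add_moment s k.*2.+3 (Num.max C1 C2).
have {}HX1 : sos_nonneg s1 'X k.+2 by apply: HX1; rewrite le_max lexx.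
have {}HXg1 : sos_nonneg s1 ('X * gap) k.+1 by apply: HXg1; rewrite le_max lexx orbT.
have H11 : sos_pos s1 1 k.+2 by apply: sos_pos_low => //; rewrite size_poly1; lia.
have Hg1 : sos_pos s1 gap k.+1 by apply: sos_pos_low => //; rewrite size_gap; lia.
have [|g [B1 [[mg sg] H12 H12' g0]]] := @extend_moment s1 1 k.+2 k.*2.+4 (monic1 _) _ H11.
  by rewrite size_poly1; lia.
have [|p [B2 [[mp sp] Hg2 _ p0]]] := @extend_moment s1 gap k.+1 k.*2.+4 gap_monic _ Hg1.
  by rewrite size_gap; lia.
have HX2 b : sos_nonneg (add_moment s1 k.*2.+4 b) 'X k.+2.
  by apply: sos_nonneg_low => //; rewrite size_polyX; lia.
have HXg2 b : sos_nonneg (add_moment s1 k.*2.+4 b) ('X * gap) k.+1.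
  by apply: sos_nonneg_low => //; rewrite sXg; lia.
have H1low b : sos_pos (add_moment s1 k.*2.+4 b) 1 k.+2.
  by apply: sos_pos_low => //; rewrite size_poly1; lia.
suff [b [zs [u [[uzs u0 sE] zsE]]]] : exists b zs u,
    atomic (add_moment s1 k.*2.+4 b) k.*2.+4 zs u /\ {in zs, forall z, in_gap_set z}.
  exists zs, u; split=> //; split=> // t tk.
  rewrite -sE; last by lia.
  by rewrite /s1 /add_moment !ltn_eqF ?mul0r ?addr0 //; lia.
(* At the larger threshold one even form acquires a null vector and the other stays nonnegative. If
   [B2] is strictly larger, the unweighted form even stays definite, as quadrature for [gap * p]
   requires. *)
have [B21|B12] := leP B2 B1.
  exists B1; apply: (@atomic_of_orthogonal _ _ k.+2 g) => //.
  - move=> h sh; rewrite -(mul1r g) g0 //; move: sh.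
    have [->|h0] := eqVneq h 0; first by rewrite size_poly0.
    by rewrite size_monicM // sg; lia.
  - exact: Hg2.
exists B2; apply: (@atomic_of_gap_orthogonal _ _ k.+1 p) => //.
- move=> h sh; rewrite p0 //; move: sh.
  have [->|h0] := eqVneq h 0; first by rewrite size_poly0.
  have mgp : gap * p \is monic by rewrite monicMr // gap_monic.
  rewrite size_monicM // (size_monicM gap_monic) ?monic_neq0 // size_gap sp; lia.
- exact: H12'.
- by apply: (@sos_nonneg_le _ _ _ k.+2) => //; apply: Hg2.
Qed.

End AtomicSolutions.

(** * Hankel matrices and recursive generation *)

Section HankelForms.
Variable R : rcfType.
Implicit Types (s : nat -> R) (f g h p q w : {poly R}) (l zs : seq R) (u : R -> R).

Section Forms.
Variables (s : nat -> R) (w : {poly R}) (m : nat) (A : 'M[R]_m).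
Hypothesis AE : forall i j, A i j = riesz s (w * 'X^(i + j)).

Let A_sym : A^T = A.
Proof. by apply/matrixP => i j; rewrite mxE !AE addnC. Qed.

Lemma psdmx_riesz : psdmx A <-> sos_nonneg s w m.
Proof.
split=> [[_ H] f sf|H].
  have := H (poly_rV f)^T; rewrite (quadratic_form_riesz _ AE) trmxK.
  by rewrite poly_rV_K.
by split=> // v; rewrite (quadratic_form_riesz _ AE) H // size_poly.
Qed.

Lemma pdmx_riesz : pdmx A <-> sos_pos s w m.
Proof.
split=> [[_ H] f f0 sf|H].
  have := H (poly_rV f)^T; rewrite (quadratic_form_riesz _ AE) trmxK poly_rV_K //.
  apply; rewrite trmx_eq0; apply: contraNneq f0 => e.
  by rewrite -(poly_rV_K sf) e linear0.
split=> // v v0; rewrite (quadratic_form_riesz _ AE) H ?size_poly //.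
apply: contraNneq v0 => e.
by rewrite -[v]trmxK -[v^T]rVpolyK e linear0 trmx0.
Qed.

End Forms.

Lemma hankel_riesz m l i j : hankel m l i j = riesz (nth 0 l) (1 * 'X^(i + j)).
Proof. by rewrite mxE mul1r riesz_Xn. Qed.

Lemma Hpos_riesz N l i j : Hpos N l i j = riesz (nth 0 l) ('X * 'X^(i + j)).
Proof. by rewrite mxE -exprS riesz_Xn addn1. Qed.

Lemma Hgap_riesz c d N l i j :
  Hgap c d N l i j = riesz (nth 0 l) (gap c d * 'X^(i + j)).
Proof. by rewrite mxE riesz_gap addn1 addn2. Qed.

Lemma Hposgap_riesz c d N l i j :
  Hposgap c d N l i j = riesz (nth 0 l) ('X * gap c d * 'X^(i + j)).
Proof. by rewrite mxE riesz_Xgap addn1 addn2 addn3. Qed.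

Definition psd_hankel m l := psdmx_riesz (@hankel_riesz m l).
Definition pd_hankel m l := pdmx_riesz (@hankel_riesz m l).
Definition psd_Hpos N l := psdmx_riesz (@Hpos_riesz N l).
Definition pd_Hpos N l := pdmx_riesz (@Hpos_riesz N l).
Definition psd_Hgap c d N l := psdmx_riesz (@Hgap_riesz c d N l).
Definition pd_Hgap c d N l := pdmx_riesz (@Hgap_riesz c d N l).
Definition psd_Hposgap c d N l := psdmx_riesz (@Hposgap_riesz c d N l).
Definition pd_Hposgap c d N l := pdmx_riesz (@Hposgap_riesz c d N l).

Lemma pdmx_unit m (A : 'M[R]_m) : pdmx A -> A \in unitmx.
Proof. by move=> [_ H]; apply: definite_unitmx => v v0; rewrite gt_eqF // H. Qed.

(** A zero of a nonnegative form is a minimum, hence a kernel vector. This links failure of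
    definiteness with the singular minors that define [hrank]. *)
Lemma psdmx_unit_pd m (A : 'M[R]_m) : psdmx A -> A \in unitmx -> pdmx A.
Proof.
move=> [A_sym H] uA; split=> // v v0; rewrite lt_def H andbT.
apply: contraNneq v0 => vAv0.
(* Move [v] along [- A v], the direction in which the form decreases. *)
pose x := A *m v; pose e : R := (x^T *m x) 0 0; pose b : R := (x^T *m A *m x) 0 0.
have b0 : 0 <= b by exact: H.
have eE : e = \sum_i x i 0 ^+ 2.
  by rewrite /e mxE; apply: eq_bigr => i _; rewrite mxE expr2.
have e0 : 0 <= e by rewrite eE sumr_ge0 // => i _; rewrite sqr_ge0.
have vAx : (v^T *m A *m x) 0 0 = e.
  by rewrite /e /x trmx_mul A_sym !mulmxA.
have xAv : (x^T *m A *m v) 0 0 = e by rewrite /e /x -mulmxA.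
have : 0 <= ((v - (e / (b + 1)) *: x)^T *m A *m (v - (e / (b + 1)) *: x)) 0 0 by exact: H.
(* The denominator is positive even for [b = 0]. The form becomes [- e^2 (b + 2) / (b + 1)^2], and
   its nonnegativity forces [e = 0]. *)
set t := e / (b + 1).
have -> : ((v - t *: x)^T *m A *m (v - t *: x)) 0 0 = - 2 * t * e + t ^+ 2 * b.
  have -> : (v - t *: x)^T = v^T - t *: x^T by rewrite linearB linearZ.
  rewrite mulmxBl mulmxBr !mulmxBl -!scalemxAl -!scalemxAr.
  move: vAv0 vAx xAv; rewrite /b !mxE => -> -> ->; ring.
have b1 : 0 < b + 1 by lra.
have -> : - 2 * t * e + t ^+ 2 * b = - (e ^+ 2 / (b + 1) ^+ 2 * (b + 2)).
  by rewrite /t; field; rewrite gt_eqF.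
rewrite oppr_ge0 pmulr_lle0; last by lra.
rewrite pmulr_lle0 ?invr_gt0 ?exprn_gt0 // real_exprn_even_le0 //= ?num_real // => /eqP e00.
have x0 : x = 0.
  apply/matrixP => i j; rewrite ord1 [RHS]mxE; apply/eqP.
  move: e00; rewrite eE => /eqP; rewrite psumr_eq0 => [/allP/(_ i)|k _]; last exact: sqr_ge0.
  by rewrite mem_index_enum sqrf_eq0; exact.
by rewrite -(mulKmx uA v) -/x x0 mulmx0.
Qed.

Lemma hrank_spec k l : hankel k.+1 l \notin unitmx ->
  [/\ (hrank k l <= k)%N, hankel (hrank k l).+1 l \notin unitmx &
      forall i, (i < hrank k l)%N -> hankel i.+1 l \in unitmx].
Proof.
move=> nu; rewrite /hrank (negPf nu); set P := fun i => _; set r := find _ _.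
have hasP : has P (iota 0 k.+1).
  by apply/hasP; exists k => //; rewrite mem_iota add0n leqnn.
have rk : (r < k.+1)%N by move: hasP; rewrite has_find size_iota.
split=> // [|i ir].
  by have := nth_find 0 hasP; rewrite nth_iota // add0n.
have := before_find 0 ir; rewrite nth_iota ?add0n; first by move/negbFE.
exact: ltn_trans rk.
Qed.

Lemma hrank_eq k l m : (m <= k)%N -> hankel k.+1 l \notin unitmx ->
  hankel m.+1 l \notin unitmx -> (forall i, (i < m)%N -> hankel i.+1 l \in unitmx) ->
  hrank k l = m.
Proof.
move=> mk nu num H; have [rk nur Hr] := hrank_spec nu.
apply/eqP; rewrite eqn_leq leqNgt (leqNgt m); apply/andP; split; apply/negP.
  by move=> /Hr; apply/negP.
by move=> /H; apply/negP.
Qed.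

(** The polynomial is the characteristic polynomial of the recursion: its orthogonality to ['X^i] is
    the recursion at index [r + i]. *)
Lemma recursive_kernel k l : pos_rec_gen k l -> ~ pdmx (hankel k.+1 l) ->
  exists r p, [/\ (r <= k)%N, p \is monic, size p = r.+1, sos_pos (nth 0 l) 1 r &
    forall h, (size (p * h)%R <= k.*2.+1)%N -> riesz (nth 0 l) (p * h) = 0].
Proof.
move=> [psd pd rec] npd.
have nu : hankel k.+1 l \notin unitmx.
  by apply/negP => u; apply: npd; exact: psdmx_unit_pd.
have [rk _ _] := hrank_spec nu; move: rec => /(_ nu).
set r := hrank k l in pd rk *; set phi := rg_coef r l => rec.
pose p0 := \sum_(i < r) phi i 0 *: 'X^i : {poly R}.
have sp0 : (size p0 <= r)%N.
  rewrite /p0; elim/big_ind: _ => [|x y sx sy|i _]; first by rewrite size_poly0.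
    by rewrite (leq_trans (size_polyD _ _)) // geq_max sx.
  by rewrite (leq_trans (size_scale_leq _ _)) // size_polyXn.
have sp : size ('X^r - p0) = r.+1.
  by rewrite size_polyDl size_polyXn // size_polyN ltnS.
have mp : 'X^r - p0 \is monic.
  apply/monicP; rewrite lead_coefE sp /= coefB coefXn eqxx.
  by rewrite nth_default // subr0.
exists r, ('X^r - p0); split=> //; first exact/pd_hankel.
move=> h; have [->|h0] := eqVneq h 0; first by rewrite mulr0 linear0.
rewrite size_monicM // sp => sh; rewrite -[h]coefK poly_def mulr_sumr linear_sum big1 //= => i _.
rewrite -scalerAr rieszZ mulrBl linearB /= -exprD riesz_Xn.
rewrite rec; last by rewrite leq_addr -ltnS (leq_trans _ sh) //= ltn_add2l.
rewrite /rg_step /p0 mulr_suml (linear_sum (riesz _)) /= -sumrB big1 ?mulr0 // => j _.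
by rewrite -scalerAl rieszZ -exprD riesz_Xn addKn addnC subrr.
Qed.

Lemma riesz_gap_seq c d N l p : (size p <= N.-1)%N ->
  riesz (nth 0 (gap_seq c d N l)) p = riesz (nth 0 l) (gap c d * p).
Proof.
by apply: riesz_twist => i iN; rewrite nth_mkseq // riesz_gap.
Qed.

Lemma monic_horner_split q m z : q \is monic -> size q = m.+1 ->
  q.[z] = \sum_(i < m) q`_i * z ^+ i + z ^+ m.
Proof.
move=> /monicP mq sq; rewrite horner_coef sq big_ord_recr /=.
by move: mq; rewrite lead_coefE sq /= => ->; rewrite mul1r.
Qed.

(** * Recursion satisfied by the moments of a finitely atomic measure *)

Section AtomicRecursion.
Variables (k : nat) (l zs : seq R) (u : R -> R).
Hypotheses (l_atomic : atomic (nth 0 l) k.*2 zs u) (size_zs : (size zs <= k)%N).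

Let q : {poly R} := \prod_(z <- zs) ('X - z%:P).
Let mu t := \sum_(z <- zs) u z * z ^+ t.
Let mq : q \is monic. Proof. exact: monic_prod_XsubC. Qed.
Let sq : size q = (size zs).+1. Proof. exact: size_prod_XsubC. Qed.

(** A nonzero polynomial of degree less than the number of atoms is nonzero at some atom. *)
Lemma atomic_sos_pos m : (m <= size zs)%N -> sos_pos (nth 0 l) 1 m.
Proof.
move=> mz f f0 sf; have [uzs u0 _] := l_atomic.
rewrite (atomic_riesz l_atomic); last first.
  by rewrite (leq_trans (size_sandwich _ f0)) // size_poly1; lia.
have nn z : z \in zs -> 0 <= u z * (1 * f ^+ 2).[z].
  by move=> zz; rewrite mul1r horner_exp mulr_ge0 ?sqr_ge0 // ltW ?u0.
rewrite big_seq lt_def sumr_ge0 // andbT; apply: contraTneq (leq_trans sf mz) => /eqP.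
rewrite psumr_eq0 // => /allP H; rewrite -ltnNge max_poly_roots //.
apply/allP => z zz; have := H z zz; rewrite zz /= mul1r horner_exp mulf_eq0.
by rewrite gt_eqF ?u0 //= sqrf_eq0.
Qed.

(** The polynomial [q] vanishes at every atom, so its coefficients form a kernel vector. *)
Lemma atomic_hankel_singular n : (size zs <= n <= k)%N -> hankel n.+1 l \notin unitmx.
Proof.
move=> /andP[zn nk]; apply/negP => uA.
have sqn : (size q <= n.+1)%N by rewrite sq.
pose v : 'cV_n.+1 := (poly_rV q)^T.
have : hankel n.+1 l *m v = 0.
  apply/matrixP => i j; rewrite !mxE.
  under eq_bigr do rewrite !mxE.
  have -> : \sum_(j0 < n.+1) l`_(i + j0) * q`_j0 = riesz (nth 0 l) ('X^i * q).
    rewrite -(@riesz_twist _ (nth 0 l) (fun t => l`_(i + t)) n.+1) //; last first.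
      by move=> t _; rewrite -exprD riesz_Xn.
    by rewrite (riesz_widen _ sqn); apply: eq_bigr => t _; rewrite mulrC.
  rewrite (atomic_riesz l_atomic).
    rewrite big_seq big1 // => z zz; rewrite hornerM.
    have /rootP -> : root q z by rewrite root_prod_XsubC.
    by rewrite !mulr0.
  have := size_polyMleq 'X^i q; rewrite size_polyXn sq; have := ltn_ord i; lia.
move=> /(congr1 (mulmx (invmx (hankel n.+1 l)))); rewrite mulKmx // mulmx0 => v0.
have : q = 0 by rewrite -(poly_rV_K sqn) -[poly_rV q]trmxK -/v v0 trmx0 linear0.
by move/eqP; rewrite -size_poly_eq0 sq.
Qed.

Lemma atomic_hrank : hrank k l = size zs.
Proof.
apply: hrank_eq => //; try by apply: atomic_hankel_singular; rewrite ?leqnn ?size_zs.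
by move=> i iz; apply/pdmx_unit/pd_hankel/atomic_sos_pos.
Qed.

(** The Hankel system defining [rg_coef] has a unique solution, and the negated lower coefficients
    of [q] solve it because [q] vanishes at every atom. *)
Lemma atomic_rg_coef i : rg_coef (size zs) l i 0 = - q`_i.
Proof.
pose psi := \col_(j < size zs) - q`_j.
suff -> : rg_coef (size zs) l = psi by rewrite mxE.
have uA : hankel (size zs) l \in unitmx by exact/pdmx_unit/pd_hankel/atomic_sos_pos.
rewrite /rg_coef -[RHS](mulKmx uA); congr (_ *m _).
have [_ _ lE] := l_atomic.
apply/matrixP => a b; rewrite !mxE lE; last by have := ltn_ord a; lia.
transitivity (- \sum_(j < size zs) mu (a + j) * q`_j); last first.
  rewrite -sumrN; apply: eq_bigr => j _; rewrite !mxE mulrN lE //.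
  by have := ltn_ord a; have := ltn_ord j; lia.
under [in RHS]eq_bigr do rewrite mulr_suml.
rewrite exchange_big /= -sumrN !big_seq; apply: eq_bigr => z zz.
have : root q z by rewrite root_prod_XsubC.
rewrite rootE (monic_horner_split _ mq sq) addrC addr_eq0 => /eqP qz.
rewrite addnC exprD qz mulrN mulr_sumr mulrN; congr (- _).
by rewrite mulr_sumr; apply: eq_bigr => j _; rewrite exprD; ring.
Qed.

(** The list [l'] is kept separate from [l] because the second step of [rg_extend] runs on the
    already extended list. *)
Lemma atomic_rg_step l' j : (size zs <= j)%N -> (forall t, (t < j)%N -> l'`_t = mu t) ->
  rg_step (rg_coef (size zs) l) l' j = mu j.
Proof.
move=> zj l'E; rewrite /rg_step.
under eq_bigr => i _.
  rewrite atomic_rg_coef l'E; last by have := ltn_ord i; lia.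
  rewrite mulr_sumr; over.
rewrite exchange_big /= /mu !big_seq; apply: eq_bigr => z zz.
have : root q z by rewrite root_prod_XsubC.
rewrite rootE (monic_horner_split _ mq sq) addrC addr_eq0 => /eqP qz.
rewrite -[in RHS](subnK zj) exprD qz !mulrN !mulr_sumr -sumrN.
by apply: eq_bigr => i _; rewrite exprD; ring.
Qed.

Lemma atomic_pos_rec_gen : pos_rec_gen k l.
Proof.
have [uzs u0 lE] := l_atomic.
rewrite /pos_rec_gen atomic_hrank; split.
- apply/psd_hankel => f sf; have [->|f0] := eqVneq f 0.
    by rewrite expr0n mulr0 linear0.
  rewrite (atomic_riesz l_atomic).
    by rewrite big_seq sumr_ge0 // => z zz; rewrite mul1r horner_exp mulr_ge0 ?sqr_ge0 // ltW ?u0.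
  by rewrite (leq_trans (size_sandwich _ f0)) // size_poly1; lia.
- exact/pd_hankel/atomic_sos_pos.
- move=> _ j /andP[zj jk]; rewrite atomic_rg_step ?lE // => t tj.
  by rewrite lE // (leq_trans (ltnW tj)).
Qed.

Hypothesis size_l : size l = k.*2.+1.

Lemma atomic_rg_extend t : (t <= k.*2.+2)%N -> (rg_extend k l)`_t = mu t.
Proof.
have [_ _ lE] := l_atomic.
rewrite /rg_extend atomic_hrank; set l1 := rcons l _.
have l1E a : (a <= k.*2.+1)%N -> l1`_a = mu a.
  rewrite /l1 nth_rcons size_l; have [ak _|ak ak1|-> _] := ltngtP a k.*2.+1.
  - by rewrite lE.
  - by lia.
  - by apply: atomic_rg_step => [|b bk]; [lia|rewrite lE].
rewrite nth_rcons size_rcons size_l.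
have [tk _|tk tk1|-> _] := ltngtP t k.*2.+2.
- by rewrite l1E.
- by lia.
- by apply: atomic_rg_step => [|b bk]; [lia|rewrite l1E].
Qed.

End AtomicRecursion.

End HankelForms.

(** * Representing measures *)

Section Concentrated.
Variable R : realType.
Variable mu : {measure set (measurableTypeR R) -> \bar R}.

(** Every point of [N] has a null open neighbourhood, hence lies in a null interval with rational
    endpoints; there are countably many of these. *)
Lemma support_null (N : set R) : open N -> N `&` Defs.support mu = set0 ->
  mu.-negligible (N : set (measurableTypeR R)).
Proof.
move=> oN NS.
pose J (pq : rat * rat) : set R := [set` `]ratr pq.1, ratr pq.2[].
(* Enumeration of the null rational intervals, padded with the empty set. *)
pose F n : set (measurableTypeR R) :=
  if unpickle n is Some pq then if mu (J pq) == 0%E then J pq else set0 else set0.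
apply: (@negligibleS _ _ _ mu (\bigcup_n F n)); last first.
  apply: negligible_bigcup => n; rewrite /F.
  case: unpickle => [pq|]; last exact: negligible_set0.
  case: eqP => [I0|_]; last exact: negligible_set0.
  by exists (J pq); split => //; exact: measurable_itv.
move=> x Nx.
have : ~ Defs.support mu x by move=> Sx; suff : set0 x by []; rewrite -NS.
move=> /existsNP[U /not_implyP[oU /not_implyP[Ux /negP]]].
rewrite -leNgt => U0.
have [e /= e0 eU] : exists2 e : R, 0 < e & ball x e `<=` U.
  have /nbhs_ballP[e /= e0 eU] : nbhs x U by exact: open_nbhs_nbhs.
  by exists e.
have [p] : exists q : rat, ratr q \in `]x - e, x[ by apply: rat_in_itvoo; rewrite ltrBlDr ltrDl.
rewrite in_itv /= => /andP[p1 p2].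
have [q] : exists q : rat, ratr q \in `]x, x + e[ by apply: rat_in_itvoo; rewrite ltrDl.
rewrite in_itv /= => /andP[q1 q2].
have [n nE] : exists n, unpickle n = Some (p, q).
  by exists (pickle (p, q)); exact: pickleK.
exists n => //; rewrite /F nE.
have IU : J (p, q) `<=` U.
  move=> y; rewrite /J /= in_itv /= => /andP[py yq]; apply: eU.
  rewrite -ball_normE /= ltr_norml; apply/andP; split; lra.
have mI : measurable (J (p, q) : set (measurableTypeR R)) by exact: measurable_itv.
have -> : mu (J (p, q)) == 0%E.
  rewrite eq_le measure_ge0 andbT (le_trans _ U0) // le_measure // inE //.
  exact: open_measurable.
by rewrite /J /= in_itv /= p2 q1.
Qed.

Section FiniteSupport.
Variables (zs : seq R) (u : R -> R).
Hypotheses (uzs : uniq zs).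
Hypothesis mu_zs : mu.-negligible (~` [set` zs] : set (measurableTypeR R)).
Hypothesis mu_z : forall z, z \in zs -> mu [set z] = (u z)%:E.

Lemma integral_finite_support (f : measurableTypeR R -> R) : measurable_fun setT f ->
  (\int[mu]_x (f x)%:E = (\sum_(z <- zs) u z * f z)%:E)%E.
Proof.
move=> mf; pose Z : set (measurableTypeR R) := \big[setU/set0]_(z <- zs) [set z].
have ZE : Z = [set` zs].
  by rewrite /Z -bigcup_seq; apply/seteqP; split => [x [y /= yz ->]|x xz] //; exists x.
have mZ : measurable Z.
  by apply: bigsetU_measurable => z _; exact: measurable_set1.
have mE : measurable_fun setT (EFin \o f) by exact/measurable_EFinP.
transitivity (\int[mu]_x (((EFin \o f) \_ Z) x))%E.
  apply: ae_eq_integral => //; first exact/measurable_restrict/measurable_funTS.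
  move: mu_zs => [B [mB B0 BZ]]; exists B; split => // x /= h; apply: BZ => /= xz.
  by apply: h => _; rewrite /patch mem_set // ZE.
rewrite -integral_mkcond integral_bigsetU_EFin //.
- rewrite -sumEFin big_seq [RHS]big_seq; apply: eq_bigr => z zz.
  transitivity (\int[mu]_(x in [set z]) cst (f z)%:E x)%E.
    by apply: eq_integral => x; rewrite inE /= => ->.
  by rewrite integral_cst ?mu_z // EFinM muleC.
- by apply/trivIsetP => i j _ _ ij; apply/seteqP; split => // x /= [-> e]; rewrite e eqxx in ij.
- exact: measurable_funTS.
Qed.

Lemma integrable_finite_support (f : measurableTypeR R -> R) : measurable_fun setT f ->
  mu.-integrable setT (EFin \o f).
Proof.
move=> mf; apply/integrableP; split; first exact/measurable_EFinP.
rewrite (@integral_finite_support (fun x => `|f x|)) ?ltry //.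
exact: measurableT_comp.
Qed.

End FiniteSupport.
End Concentrated.

Section RepresentingMeasure.
Variable R : realType.

Implicit Types (E : set R) (g zs : seq R) (u : R -> R) (p W : {poly R})
  (mu : {measure set (measurableTypeR R) -> \bar R}).

Lemma measurable_horner p :
  measurable_fun setT (fun x : measurableTypeR R => p.[x : R]).
Proof. by apply: continuous_measurable_fun; exact: continuous_horner. Qed.

Lemma integral_horner E g mu p : representing E g mu -> (size p <= size g)%N ->
  mu.-integrable setT (fun x => (p.[x : R])%:E) /\
  (\int[mu]_x (p.[x : R])%:E = (riesz (nth 0 g) p)%:E)%E.
Proof.
move=> [_ H] sp.
have pE : (fun x : measurableTypeR R => (p.[x : R])%:E) =
    (fun x => \sum_(i < size p) (p`_i)%:E * ((x : R) ^+ i)%:E)%E.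
  apply/funext => x; rewrite horner_coef -sumEFin.
  by apply: eq_bigr => i _; rewrite EFinM.
have Hi (i : 'I_(size p)) := H i (leq_trans (ltn_ord i) sp).
have Ii (i : 'I_(size p)) :
    mu.-integrable setT (fun x => (p`_i)%:E * ((x : R) ^+ i)%:E)%E.
  by apply: integrableZl => //; exact: (Hi i).1.
split; first by rewrite pE; exact: integrable_sum.
rewrite [in LHS]pE integral_sum // /riesz -sumEFin; apply: eq_bigr => i _.
by rewrite integralZl //; [rewrite (Hi i).2 EFinM|exact: (Hi i).1].
Qed.

Lemma representing_null E g mu : closed E -> representing E g mu ->
  mu.-negligible (~` E : set (measurableTypeR R)).
Proof.
move=> cE [sE _]; apply: support_null; first exact: closed_openC.
by apply/seteqP; split => // x [nE /sE].
Qed.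

Lemma integral_on_support E g mu p : closed E -> representing E g mu ->
  (\int[mu]_x (p.[x : R])%:E = \int[mu]_(x in E) (p.[x : R])%:E)%E.
Proof.
move=> cE repE; have mE : measurable (E : set (measurableTypeR R)).
  exact: closed_measurable.
have mp : measurable_fun setT (EFin \o (fun x : measurableTypeR R => p.[x : R])).
  by apply/measurable_EFinP; exact: measurable_horner.
rewrite [RHS]integral_mkcond; apply: ae_eq_integral => //.
  exact/measurable_restrict/measurable_funTS.
have [B [mB B0 BE]] := representing_null cE repE.
exists B; split => // x /= h; apply: BE => /= Ex.
by apply: h => _; rewrite /patch mem_set.
Qed.

Lemma representing_riesz_ge0 E g mu W : closed E -> representing E g mu ->
  (size W <= size g)%N -> (forall x, E x -> 0 <= W.[x]) -> 0 <= riesz (nth 0 g) W.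
Proof.
move=> cE repE sW W0; have [_ e] := integral_horner repE sW.
by rewrite -lee_fin -e (integral_on_support _ cE repE) integral_ge0.
Qed.

(** A function nonnegative on E with zero integral vanishes almost everywhere there, so [mu] is
    carried by the finitely many real roots of [W]. *)
Lemma representing_singular E g mu W : closed E -> representing E g mu ->
  W != 0 -> (size W <= size g)%N -> (forall x, E x -> 0 <= W.[x]) ->
  riesz (nth 0 g) W = 0 ->
  exists zs u, atomic (nth 0 g) (size g).-1 zs u /\
    forall z, z \in zs -> E z /\ root W z.
Proof.
move=> cE repE Wn0 sW W0 rW; have [_ e] := integral_horner repE sW.
have mE : measurable (E : set (measurableTypeR R)) by exact: closed_measurable.
pose rs := polyrcf.rootsR W.
have rsE z : (z \in rs) = root W z.
  by have := polyrcf.roots_on_rootsR Wn0 z; rewrite -/rs in_itv /= => <-.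
have urs : uniq rs by exact: polyrcf.uniq_roots.
have mW : measurable_fun (E : set (measurableTypeR R)) (fun x => (W.[x : R])%:E).
  by apply/measurable_EFinP; apply: measurable_funTS; exact: measurable_horner.
have rs_null : mu.-negligible (~` [set` rs] : set (measurableTypeR R)).
  have : (\int[mu]_(x in E) `|(W.[x : R])%:E| = 0)%E.
    rewrite -[RHS](_ : 0%:E = 0%E) // -rW -e (integral_on_support _ cE repE).
    by apply: eq_integral => x; rewrite inE => Ex; rewrite gee0_abs // lee_fin W0.
  move=> /(ae_eq_integral_abs mu mE mW) W_ae.
  apply: (@negligibleS _ _ _ mu ((~` E) `|` [set x | ~ (E x -> (W.[x : R])%:E = 0%E)])).
    move=> x /= xrs; have [Ex|] := pselect (E x); [right|by left].
    by move=> /(_ Ex) [] /eqP; rewrite -rootE -rsE => h; apply: xrs.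
  apply: negligibleU; first exact: representing_null repE.
  exact: W_ae.
(* The moment of index 0 bounds the total mass, so every point mass is a real number. *)
have g_gt0 : (0 < size g)%N by rewrite (leq_trans _ sW) // size_poly_gt0.
have muT : (mu setT < +oo)%E.
  have [_ H] := repE; have [_] := H 0 g_gt0.
  rewrite (_ : (fun x : measurableTypeR R => _) = cst 1%:E); last first.
    by apply/funext => x; rewrite expr0.
  by rewrite integral_cst // mul1e => ->; rewrite ltry.
pose u z := fine (mu [set z]).
have muE z : mu [set z] = (u z)%:E.
  rewrite /u fineK // fin_num_abs gee0_abs ?measure_ge0 // (le_lt_trans _ muT) //.
  by rewrite le_measure // inE //; exact: measurable_set1.
have u_ge0 z : 0 <= u z by rewrite -lee_fin -muE measure_ge0.
(* Discarding the roots of zero mass leaves positive weights; a point of positive mass lies in the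
   support, hence in E. *)
exists [seq z <- rs | u z != 0], u; split; last first.
  move=> z; rewrite mem_filter -rsE => /andP[uz zrs]; split => //.
  apply: repE.1 => U oU Uz; apply: (@lt_le_trans _ _ (mu [set z])).
    by rewrite muE lte_fin lt_def uz u_ge0.
  have mU : measurable (U : set (measurableTypeR R)) by exact: open_measurable.
  by rewrite le_measure ?inE // => x /= ->.
split; first exact: filter_uniq.
  by move=> z; rewrite mem_filter lt_def => /andP[-> _]; rewrite u_ge0.
move=> t; rewrite -ltnS prednK // => tg.
have [_ H] := repE; have [_] := H t tg.
rewrite (integral_finite_support urs rs_null (fun z _ => muE z)); last first.
  exact: exprn_measurable.
move=> [<-]; rewrite big_filter [LHS](bigID (fun z => u z != 0)) /=.
by rewrite [X in _ + X]big1 ?addr0 // => z /negPn/eqP ->; rewrite mul0r.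
Qed.

Lemma atomic_representing E g zs u : closed E -> atomic (nth 0 g) (size g).-1 zs u ->
  (forall z, z \in zs -> E z) ->
  exists mu, finitely_atomic mu /\ representing E g mu.
Proof.
move=> cE [uzs u0 gE] zsE.
(* The index [i] ranges over all naturals, so the absolute value ensures a nonnegative scalar
   everywhere; at the atoms it is [u z]. *)
pose m i : {measure set (measurableTypeR R) -> \bar R} :=
  mscale (NngNum (normr_ge0 (u zs`_i))) (dirac (zs`_i : measurableTypeR R)).
pose mu : {measure set (measurableTypeR R) -> \bar R} := msum m (size zs).
have muE A : mu A = (\sum_(i < size zs) (u zs`_i)%:E * \d_(zs`_i) A)%E.
  rewrite /mu /= /msum; apply: eq_bigr => i _; rewrite /m /= /mscale /=.
  by rewrite gtr0_norm // u0 // mem_nth.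
have mu0 A : (forall z, z \in zs -> ~ A z) -> mu A = 0%E.
  move=> H; rewrite muE big1 // => i _; rewrite diracE memNset ?mule0 //.
  by apply: H; rewrite mem_nth.
have mu_z z : z \in zs -> mu [set z] = (u z)%:E.
  move=> zz; rewrite muE; have iz : (index z zs < size zs)%N by rewrite index_mem.
  rewrite (bigD1 (Ordinal iz)) //= nth_index // diracE mem_set // mule1.
  rewrite big1 ?adde0 // => i ij; rewrite diracE memNset ?mule0 //= => e.
  by move: ij; rewrite -val_eqE /= -e index_uniq ?eqxx // ltn_ord.
have mu_null : mu.-negligible (~` [set` zs] : set (measurableTypeR R)).
  exists (~` [set` zs]); split => //; last first.
    by apply: mu0 => z zz /=; exact.
  apply: measurableC; rewrite (_ : [set` zs] = \big[setU/set0]_(z <- zs) [set z]).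
    by apply: bigsetU_measurable => z _; exact: measurable_set1.
  by rewrite -bigcup_seq; apply/seteqP; split => [x xz|x [y /= yz ->]] //; exists x.
exists mu; split.
  exists (size zs), (fun i => zs`_i), (fun i => u zs`_i); split.
  - move=> i j /eqP; rewrite nth_uniq // => /eqP; exact: val_inj.
  - by move=> i; rewrite u0 // mem_nth.
  - by move=> A _; exact: muE.
split=> [x|t tg] /=.
  apply: contraPP => nEx Sx.
  have /Sx/(_ nEx) : open (~` E) by exact: closed_openC.
  by rewrite mu0 ?ltxx // => z /zsE Ez; exact.
split.
  exact: (integrable_finite_support uzs mu_null mu_z (exprn_measurable _)).
rewrite (integral_finite_support uzs mu_null mu_z) ?gE //.
by rewrite -ltnS prednK // (leq_trans _ tg).
Qed.

End RepresentingMeasure.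

(** * Matrix conditions *)

Section Conditions.
Variable R : rcfType.
Variables (c d : R).
Implicit Types (s : nat -> R) (f p w W : {poly R}) (l zs : seq R) (u : R -> R).
Local Notation gap := (gap c d).
Local Notation in_gap_set := (in_gap_set c d).

(** The sizes are those of the four matrices for [N = 2(k + 1)]: each [w * f ^+ 2] tested has degree
    at most [N]. *)
Definition all_forms (Q : (nat -> R) -> {poly R} -> nat -> Prop) s k :=
  [/\ Q s 1 k.+2, Q s 'X k.+1, Q s gap k.+1 & Q s ('X * gap) k].

Let half_double k : (k.+1.*2)./2 = k.+1. Proof. by rewrite doubleK. Qed.
Let half_pred_double k : (k.+1.*2.-1)./2 = k.
Proof. by rewrite doubleS /= uphalf_double. Qed.

Lemma all_psd_riesz k l : all_psd c d k.+1.*2 l <-> all_forms (@sos_nonneg R) (nth 0 l) k.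
Proof.
have H N : all_psd c d N l <-> [/\ sos_nonneg (nth 0 l) 1 N./2.+1,
    sos_nonneg (nth 0 l) 'X N.-1./2.+1, sos_nonneg (nth 0 l) gap N./2 &
    sos_nonneg (nth 0 l) ('X * gap) N.-1./2].
  by split=> -[/psd_hankel ? /psd_Hpos ? /psd_Hgap ? /psd_Hposgap ?].
by have := H k.+1.*2; rewrite half_pred_double half_double.
Qed.

Lemma all_pd_riesz k l : all_pd c d k.+1.*2 l <-> all_forms (@sos_pos R) (nth 0 l) k.
Proof.
have H N : all_pd c d N l <-> [/\ sos_pos (nth 0 l) 1 N./2.+1,
    sos_pos (nth 0 l) 'X N.-1./2.+1, sos_pos (nth 0 l) gap N./2 &
    sos_pos (nth 0 l) ('X * gap) N.-1./2].
  by split=> -[/pd_hankel ? /pd_Hpos ? /pd_Hgap ? /pd_Hposgap ?].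
by have := H k.+1.*2; rewrite half_pred_double half_double.
Qed.

Lemma singular_form s' w m : sos_nonneg s' w m -> ~ sos_pos s' w m ->
  exists f, [/\ f != 0, (size f <= m)%N & riesz s' (w * f ^+ 2) = 0].
Proof.
move=> H; apply: contra_notP => nf f f0 sf; rewrite lt_def H // andbT.
by apply/eqP => e; apply: nf; exists f.
Qed.

Lemma all_forms_nonneg k' s' :
  (forall W, (size W <= k'.+1.*2.+1)%N -> (forall x, in_gap_set x -> 0 <= W.[x]) ->
    0 <= riesz s' W) -> all_forms (@sos_nonneg R) s' k'.
Proof.
move=> H; have Hw w m : (size w + m.*2 <= k'.+1.*2.+3)%N ->
    (forall x, in_gap_set x -> 0 <= w.[x]) -> sos_nonneg s' w m.
  move=> swm w0 f sf; have [->|f0] := eqVneq f 0; first by rewrite expr0n mulr0 linear0.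
  apply: H => [|x Ex]; last by rewrite hornerM horner_exp mulr_ge0 ?sqr_ge0 ?w0.
  by rewrite (size_sandwich_le sf) //; lia.
have gap0 x : in_gap_set x -> 0 <= gap.[x] by move=> /andP[].
have X0 x : in_gap_set x -> 0 <= x by move=> /andP[].
have sXg : (size ('X * gap)%R <= 4)%N.
  by rewrite (leq_trans (size_polyMleq _ _)) // size_polyX size_gap.
split; apply: Hw.
- by rewrite size_poly1; lia.
- by move=> x _; rewrite hornerC.
- by rewrite size_polyX; lia.
- by move=> x; rewrite hornerX; exact: X0.
- by rewrite size_gap; lia.
- exact: gap0.
- by lia.
- by move=> x Ex; rewrite hornerM hornerX; apply: mulr_ge0; [exact: X0|exact: gap0].
Qed.

Lemma atomic_all_psd k' l zs u : atomic (nth 0 l) k'.+1.*2 zs u ->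
  {in zs, forall z, in_gap_set z} -> all_psd c d k'.+1.*2 l.
Proof.
move=> a zsE; apply/all_psd_riesz/all_forms_nonneg => W sW W0.
rewrite (atomic_riesz a sW) big_seq sumr_ge0 // => z zz.
by have [_ u0 _] := a; rewrite mulr_ge0 ?W0 ?zsE // ltW ?u0.
Qed.

Section Singular.
Variables (k : nat) (g : seq R).
Hypothesis size_g : size g = k.+1.*2.+1.
Let s := nth 0 g.

Lemma size_gap_seq : size (gap_seq c d k.+1.*2 g) = k.*2.+1.
Proof. by rewrite size_mkseq. Qed.

(** Multiplying each weight by [gap.[z]] gives an atomic measure for [gap_seq]; atoms at roots of
    [gap] disappear. Its recursive continuation determines the next two moments of the original
    measure. *)
Lemma gap_extend_atomic zs u : atomic s k.+1.*2 zs u ->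
  {in zs, forall z, in_gap_set z} -> (size [seq z <- zs | gap.[z] != 0%R] <= k)%N ->
  pos_rec_gen k (gap_seq c d k.+1.*2 g) /\
  atomic (nth 0 (gap_extend c d k.+1.*2 g)) k.+2.*2 zs u.
Proof.
move=> a zsE; set zs' := [seq z <- zs | _] => szs'; have [uzs u0 sE] := a.
pose u' z := u z * gap.[z].
pose mu t := \sum_(z <- zs) u z * z ^+ t.
have muE t : \sum_(z <- zs') u' z * z ^+ t = c * d * mu t - (c + d) * mu t.+1 + mu t.+2.
  rewrite /zs' big_filter /mu !mulr_sumr -sumrB -big_split /=.
  rewrite [RHS](bigID (fun z => gap.[z] != 0)) /= [X in _ = _ + X]big1 ?addr0.
    by apply: eq_bigr => z _; rewrite /u' horner_gap !exprS; ring.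
  move=> z /negPn/eqP gz.
  transitivity (u z * gap.[z] * z ^+ t); last by rewrite gz mulr0 mul0r.
  by rewrite horner_gap !exprS; ring.
have a' : atomic (nth 0 (gap_seq c d k.+1.*2 g)) k.*2 zs' u'.
  split; first exact: filter_uniq.
    move=> z; rewrite mem_filter => /andP[gz zz].
    have /andP[_ g0] := zsE z zz.
    by rewrite mulr_gt0 ?u0 // lt_def gz.
  move=> t tk; rewrite nth_mkseq; last by rewrite doubleS /=; lia.
  by rewrite muE -/s !sE //; lia.
split; first exact: (atomic_pos_rec_gen a' szs').
have ext := atomic_rg_extend a' szs' size_gap_seq.
pose e := rg_extend k (gap_seq c d k.+1.*2 g).
pose g1 := e`_(k.*2.+1) + (c + d) * s k.+1.*2 - c * d * s k.*2.+1.
pose g2 := e`_(k.*2.+2) + (c + d) * g1 - c * d * s k.+1.*2.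
have -> : gap_extend c d k.+1.*2 g = rcons (rcons g g1) g2.
  by rewrite /gap_extend half_double.
have sk : s k.+1.*2 = mu k.+1.*2 by rewrite sE.
have sk1 : s k.*2.+1 = mu k.*2.+1 by rewrite sE // doubleS.
(* The definition of [g1] solves [muE] at [t = 2k + 1] for its top moment; [g2] does the same one
   index later. *)
have g1E : g1 = mu k.*2.+3 by rewrite /g1 ext // muE sk1 sk doubleS; ring.
have g2E : g2 = mu k.*2.+4 by rewrite /g2 g1E ext // muE sk doubleS; ring.
split=> // t; rewrite nth_rcons size_rcons size_g => tk.
have [t2|t2|->] := ltngtP t k.+1.*2.+2; [|by lia|by rewrite g2E].
rewrite nth_rcons size_g.
by have [t1|t1|->] := ltngtP t k.+1.*2.+1; [rewrite -/(s t) sE|lia|rewrite g1E].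
Qed.

Let N := k.+1.*2.

Lemma pd_Hgap_seq : pdmx (Hgap c d N g) <-> pdmx (hankel k.+1 (gap_seq c d N g)).
Proof.
rewrite /N; have h1 := @pd_Hgap R c d k.+1.*2 g.
have h2 := @pd_hankel R k.+1 (gap_seq c d k.+1.*2 g).
apply: (iff_trans h1); apply: iff_sym; apply: (iff_trans h2).
rewrite -/N half_double.
have e (f : {poly R}) : (size f <= k.+1)%N -> f != 0 ->
    riesz (nth 0 (gap_seq c d N g)) (1 * f ^+ 2) = riesz s (gap * f ^+ 2).
  move=> sf f0; rewrite [in LHS]riesz_gap_seq ?mul1r // -[f ^+ 2]mul1r.
  by rewrite (size_sandwich_le sf) // size_poly1 /N doubleS.
by split=> H f f0 sf; have := H f f0 sf; rewrite e.
Qed.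

Lemma atomic_of_singular_HR : all_psd c d N g -> ~ pdmx (HR N g) -> pos_rec_gen N./2 g ->
  exists zs u, atomic s N zs u /\ {in zs, forall z, in_gap_set z}.
Proof.
move=> /all_psd_riesz[H1 HX Hg HXg] npd rec.
have [r [p [rk mp sp H1r p0]]] := recursive_kernel rec npd.
rewrite half_double in rk p0.
apply: (@atomic_of_orthogonal _ _ _ _ _ r p) => //.
- by rewrite /N leq_double.
- exact: sos_nonneg_le HX.
- exact: sos_nonneg_le Hg.
Qed.

Lemma atomic_riesz_eq0 zs u W : atomic s N zs u -> (size W <= N.+1)%N ->
  {in zs, forall z, root W z} -> riesz s W = 0.
Proof.
move=> a sW H; rewrite (atomic_riesz a sW) big_seq big1 // => z /H /rootP ->.
by rewrite mulr0.
Qed.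

(** * Necessity of the matrix conditions *)

Section NecessaryConditions.
Hypothesis s_nonneg : all_forms (@sos_nonneg R) s k.
(** Together with nonnegativity, this is the only trace of the measure here; [representing_singular]
    provides it. *)
Hypothesis s_singular : forall W, W != 0 -> (size W <= N.+1)%N ->
  (forall x, in_gap_set x -> 0 <= W.[x]) -> riesz s W = 0 ->
  exists zs u, [/\ atomic s N zs u, {in zs, forall z, in_gap_set z} &
    {in zs, forall z, root W z}].

Lemma singular_sandwich w m : (0 < size w)%N -> (size w + m.*2 <= N.+3)%N ->
  (forall x, in_gap_set x -> 0 <= w.[x]) -> sos_nonneg s w m -> ~ sos_pos s w m ->
  exists f zs u, [/\ f != 0, (size f <= m)%N, atomic s N zs u,
    {in zs, forall z, in_gap_set z} & {in zs, forall z, root w z || root f z}].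
Proof.
move=> w_gt0 swm w0 nn npos; have [f [f0 sf rf]] := singular_form nn npos.
have [||x Ex|//|zs [u [a zsE zsr]]] := @s_singular (w * f ^+ 2).
- by rewrite mulf_neq0 ?expf_neq0 // -size_poly_gt0.
- by rewrite (size_sandwich_le sf) //; lia.
- by rewrite hornerM horner_exp mulr_ge0 ?sqr_ge0 ?w0.
exists f, zs, u; split=> // z /zsr.
by rewrite rootM /root horner_exp sqrf_eq0.
Qed.

Lemma in_gap_set_hornerX_ge0 x : in_gap_set x -> 0 <= ('X : {poly R}).[x].
Proof. by rewrite hornerX => /andP[]. Qed.

Lemma in_gap_set_gap_ge0 x : in_gap_set x -> 0 <= gap.[x].
Proof. by move=> /andP[]. Qed.

(* A null vector [f] of the form of weight ['X] forces all atoms to be roots of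
   ['X * f], which is then a null vector of the unweighted form. *)
Lemma Hpos_pd : sos_pos s 1 k.+2 -> sos_pos s 'X k.+1.
Proof.
move=> H1; have [_ HX _ _] := s_nonneg; apply: contrapT => npos.
have [||f [zs [u [f0 sf a _ zsr]]]] := singular_sandwich _ _ in_gap_set_hornerX_ge0 HX npos.
- by rewrite size_polyX.
- by rewrite size_polyX /N; lia.
have Xf0 : 'X * f != 0 by rewrite mulf_neq0 ?polyX_eq0.
have sXf : (size ('X * f)%R <= k.+2)%N by rewrite size_monicM ?monicX // size_polyX.
have := H1 _ Xf0 sXf; rewrite (atomic_riesz_eq0 a) ?ltxx //.
  by rewrite (size_sandwich_le sXf) // size_poly1 /N; lia.
by move=> z /zsr; rewrite mul1r /root horner_exp hornerM sqrf_eq0 mulf_eq0.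
Qed.

(** As for weight ['X]: all atoms are roots of ['X * gap * f], so ['X * f] is a null vector of the
    form of weight [gap]. *)
Lemma Hposgap_pd : sos_pos s gap k.+1 -> sos_pos s ('X * gap) k.
Proof.
move=> Hg; have [_ _ _ HXg] := s_nonneg; apply: contrapT => npos.
have sXg : size ('X * gap)%R = 4.
  by rewrite size_Mmonic ?polyX_eq0 ?gap_monic // size_polyX size_gap.
have [|||f [zs [u [f0 sf a _ zsr]]]] := singular_sandwich _ _ _ HXg npos.
- by rewrite sXg.
- by rewrite sXg /N; lia.
- move=> x Ex; rewrite hornerM; apply: mulr_ge0; [exact: in_gap_set_hornerX_ge0|exact: in_gap_set_gap_ge0].
have Xf0 : 'X * f != 0 by rewrite mulf_neq0 ?polyX_eq0.
have sXf : (size ('X * f)%R <= k.+1)%N by rewrite size_monicM ?monicX // size_polyX.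
have := Hg _ Xf0 sXf; rewrite (atomic_riesz_eq0 a) ?ltxx //.
  by rewrite (size_sandwich_le sXf) // size_gap /N; lia.
by move=> z /zsr; rewrite expr2 !rootM => /orP[/orP[]|] ->; rewrite ?orbT.
Qed.

(** By [Hpos_pd] and [Hposgap_pd], definiteness can first fail only at the first or the third
    matrix. In either case the measure is atomic and the extended moments are again its moments. *)
Lemma singular_or_pd_conditions : all_psd c d N g /\
  (all_pd c d N g \/
   ([/\ ~ pdmx (HR N g), pos_rec_gen N./2 g & all_psd c d N.+2 (rg_extend N./2 g)] \/
    [/\ [/\ pdmx (HR N g), pdmx (Hpos N.-1 g) & ~ pdmx (Hgap c d N g)],
        pos_rec_gen N./2.-1 (gap_seq c d N g) &
        all_psd c d N.+2 (gap_extend c d N g)])).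
Proof.
have [H1 HX Hg HXg] := s_nonneg; split; first exact/all_psd_riesz.
have pdHR : pdmx (HR N g) <-> sos_pos s 1 k.+2.
  by rewrite -(half_double k); exact: pd_hankel.
have pdHpos : pdmx (Hpos N.-1 g) <-> sos_pos s 'X k.+1.
  by rewrite -(half_pred_double k); exact: pd_Hpos.
have pdHgap : pdmx (Hgap c d N g) <-> sos_pos s gap k.+1.
  by rewrite -(half_double k); exact: pd_Hgap.
have [npd|npd] := pselect (sos_pos s 1 k.+2); last first.
  right; left.
  have [||x Ex|f [zs [u [f0 sf a zsE zsr]]]] := singular_sandwich _ _ _ H1 npd.
  - by rewrite size_poly1.
  - by rewrite size_poly1 /N; lia.
  - by rewrite hornerC.
  (* The constant weight 1 has no roots, so every atom is a root of [f], of degree at most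
     [k + 1]. *)
  have szs : (size zs <= k.+1)%N.
    rewrite -ltnS (leq_trans _ sf) // max_poly_roots //; last by have [] := a.
    apply/allP => z /zsr; rewrite /root hornerC oner_eq0; exact.
  split; first by rewrite pdHR.
    rewrite half_double; exact: (atomic_pos_rec_gen a szs).
  apply: (@atomic_all_psd k.+1 _ zs u) => //; rewrite half_double.
  have [uzs u0 _] := a; split=> // t tN.
  exact: (atomic_rg_extend a szs size_g).
have pdX := Hpos_pd npd.
have [npg|npg] := pselect (sos_pos s gap k.+1).
  by left; apply/all_pd_riesz; split=> //; exact: Hposgap_pd.
right; right; have [||f [zs [u [f0 sf a zsE zsr]]]] := singular_sandwich _ _ in_gap_set_gap_ge0 Hg npg.
- by rewrite size_gap.
- by rewrite size_gap /N; lia.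
(* Atoms that are not roots of [gap] are roots of [f], now of degree at most [k]. *)
have szs : (size [seq z <- zs | gap.[z] != 0%R] <= k)%N.
  rewrite -ltnS (leq_trans _ sf) // max_poly_roots //.
    by apply/allP => z; rewrite mem_filter => /andP[gz /zsr]; rewrite /root (negPf gz).
  by rewrite filter_uniq //; have [] := a.
have [rec ext] := gap_extend_atomic a zsE szs.
split; first by split; [exact/pdHR|exact/pdHpos|move/pdHgap].
  by rewrite half_double.
exact: atomic_all_psd ext zsE.
Qed.

End NecessaryConditions.

Hypotheses (c_gt0 : 0 < c) (cd : c < d).

(** The recursion polynomial [p] of [gap_seq] annihilates the functional weighted by [gap], so
    [gap * p] annihilates the original one. *)
Lemma atomic_of_singular_Hgap : all_psd c d N g -> pdmx (HR N g) -> ~ pdmx (Hgap c d N g) ->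
  pos_rec_gen N./2.-1 (gap_seq c d N g) ->
  exists zs u, atomic s N zs u /\ {in zs, forall z, in_gap_set z}.
Proof.
move=> /all_psd_riesz[H1 HX Hg HXg] /pd_hankel pd npd; rewrite half_double /= => rec.
rewrite half_double in pd.
have npd' : ~ pdmx (hankel k.+1 (gap_seq c d N g)) by move=> /pd_Hgap_seq.
have [r [p [rk mp sp H1r p0]]] := recursive_kernel rec npd'.
apply: (@atomic_of_gap_orthogonal _ _ _ (ltW c_gt0) (ltW (lt_trans c_gt0 cd)) _ _ r p) => //.
- by rewrite /N doubleS !ltnS leq_double.
- move=> h; rewrite -mulrA.
  have [->|ph0] := eqVneq (p * h) 0; first by rewrite mulr0 linear0.
  rewrite (size_monicM (gap_monic c d)) // size_gap => sh.
  rewrite -(@riesz_gap_seq _ c d N); last by move: sh; rewrite /N doubleS.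
  by rewrite p0 //; move: sh; rewrite /N doubleS.
- by move=> f f0 sf; apply: pd => //; apply: leq_trans sf _.
- by apply: sos_nonneg_le Hg; exact: leqW.
- exact: sos_nonneg_le HXg.
Qed.

Lemma atomic_of_all_pd : all_pd c d N g ->
  exists zs u, atomic s N zs u /\ {in zs, forall z, in_gap_set z}.
Proof.
move=> /all_pd_riesz[H1 HX Hg HXg].
exact: (atomic_of_positive_definite (ltW c_gt0) (ltW (lt_trans c_gt0 cd))).
Qed.

End Singular.

End Conditions.

(** * The set E and the equivalence *)

Lemma in_gap_setP (R : realType) (c d x : R) : 0 < c -> c < d ->
  (`[0, c] `|` `[d, +oo[ : set R) x <-> in_gap_set c d x.
Proof.
move=> c_gt0 cd; rewrite /in_gap_set horner_gap /= !in_itv /= andbT; split.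
  move=> [/andP[x0 xc]|dx].
    by rewrite x0 /= mulr_le0 // subr_le0 // (le_trans xc) // ltW.
  have cx : c <= x by rewrite (le_trans _ dx) // ltW.
  by rewrite (le_trans (ltW c_gt0) cx) mulr_ge0 // subr_ge0.
move=> /andP[x0 h]; have [xc|cx] := leP x c; first by left; rewrite x0.
by right; move: h; rewrite pmulr_rge0 ?subr_ge0 ?subr_gt0.
Qed.

Lemma closed_gap_set (R : realType) (c d : R) : closed (`[0, c] `|` `[d, +oo[ : set R).
Proof. by apply: closedU; [exact: interval_closed|exact: interval_closed]. Qed.

Theorem theorem5p5 (R : realType) (n : nat) (hn : (3 <= n)%N) (n_even : ~~ odd n)
    (c d : R) (hc : 0 < c) (hcd : c < d) (gamma : (3 * n).+1.-tuple R) :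
  let E : set R := `[0, c] `|` `[d, +oo[ in
  let N := (3 * n)%N in
  let representable := exists mu : {measure set (measurableTypeR R) -> \bar R},
    representing E gamma mu in
  let fin_representable :=
    exists mu : {measure set (measurableTypeR R) -> \bar R},
      finitely_atomic mu /\ representing E gamma mu in
  (* the first matrix that is not positive definite is the first one *)
  let case_HR :=
    [/\ ~ pdmx (HR N gamma),
        pos_rec_gen N./2 gamma &
        all_psd c d N.+2 (rg_extend N./2 gamma)] in
  (* the first matrix that is not positive definite is the third one *)
  let case_Hgap :=
    [/\ [/\ pdmx (HR N gamma), pdmx (Hpos N.-1 gamma) &
            ~ pdmx (Hgap c d N gamma)],
        pos_rec_gen N./2.-1 (gap_seq c d N gamma) &
        all_psd c d N.+2 (gap_extend c d N gamma)] in
  let matrix_conditions :=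
    all_psd c d N gamma /\
    (all_pd c d N gamma \/ (case_HR \/ case_Hgap)) in
  (representable <-> fin_representable) /\
  (representable <-> matrix_conditions).
Proof.
move=> E N representable fin_representable case_HR case_Hgap matrix_conditions.
have EP x : E x <-> in_gap_set c d x by exact: in_gap_setP.
have cE : closed E by exact: closed_gap_set.
(* Evenness of [n] makes [N] even, and [3 <= n] makes it positive. *)
have [k NE] : exists k, N = k.+1.*2.
  exists N./2.-1; rewrite prednK; first by rewrite even_halfK // /N oddM negb_and n_even orbT.
  by rewrite half_gt0 /N; lia.
have size_g : size gamma = k.+1.*2.+1 by rewrite size_tuple -NE.
have fin_rep : fin_representable -> representable by move=> [mu [_ ?]]; exists mu.
have rep_matrix : representable -> matrix_conditions.
  move=> [mu rep]; rewrite /matrix_conditions /case_HR /case_Hgap NE.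
  apply: (singular_or_pd_conditions size_g) => [|W W0 sW Wge rW].
    apply: all_forms_nonneg => W sW W0.
    by apply: (representing_riesz_ge0 cE rep) => [|x /EP]; [rewrite size_g|exact: W0].
  have [||zs [u [a zsE]]] := representing_singular cE rep W0 _ _ rW.
  - by rewrite size_g.
  - by move=> x /EP; exact: Wge.
  exists zs, u; split; first by move: a; rewrite size_g.
    by move=> z /zsE[/EP].
  by move=> z /zsE[].
have matrix_fin : matrix_conditions -> fin_representable.
  move=> mc; have [zs [u [a zsE]]] : exists zs u,
      atomic (nth 0 gamma) k.+1.*2 zs u /\ {in zs, forall z, in_gap_set c d z}.
    move: mc; rewrite /matrix_conditions /case_HR /case_Hgap NE.
    move=> [psd [pd|[[npd rec _]|[[pd _ npd] rec _]]]].
    - exact: atomic_of_all_pd hc hcd pd.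
    - exact: atomic_of_singular_HR psd npd rec.
    - exact: atomic_of_singular_Hgap hc hcd psd pd npd rec.
  apply: (atomic_representing cE (zs := zs) (u := u)); first by rewrite size_g.
  by move=> z /zsE /EP.
split; split=> //; first by move=> /rep_matrix /matrix_fin.
by move=> /matrix_fin /fin_rep.
Qed.
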